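(* Let $N\ge 1$, $\alpha_1,\dots,\alpha_N\in\{0,1\}$, $R(z)=\exp(r(z))\in \mathrm{Id}+z\,\mathrm{End}(\mathbb C^N)[[z]]$, $T(z)=\sum_{j\ge1}\sum_a\Delta T^a_j z^j\tilde e_a\in z\mathbb C^N[[z]]$ with $\Delta T_1^a=0$ whenever $\alpha_a=1$, and $\Delta\in(\mathbb C\setminus\{0\})^N$ (with fixed square roots). Let $\widehat L^a_m$ ($1\le a\le N$, $m\ge-\alpha_a$) be the associated Virasoro operators and $\widehat H$ the associated deformed dimension operator (defined in the context). Then the Virasoro constraints together with the deformed dimension constraint imply a cubic cut-and-join equation: there is an operator of the form $$\widehat W'=\sum_{a,b,c=1}^N\ \sum_{\substack{i\le j\le k\\ i+j+k\ge0}}A^{i,j,k}_{a,b,c}\,\widehat J^a_i\widehat J^b_j\widehat J^c_k+\sum_{a=1}^N\sum_{j=-1}^\infty B^j_a\widehat J^a_j,$$ with $A^{i,j,k}_{a,b,c},B^j_a\in\mathbb C$ independent of $\mathbf T$ and $\hbar$, such that every $Z\in\mathbb C[\mathbf T][[\hbar]]$ satisfying $$\widehat L^a_m\cdot Z=0\quad(1\le a\le N,\ m\ge-\alpha_a)\qquad\text{and}\qquad\hbar\frac{\partial}{\partial\hbar}Z=\widehat H\cdot Z$$ satisfies $$\frac{\partial}{\partial\hbar}Z=\widehat W'\cdot Z .$$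
   Context: Notation. $(2k-1)!!=1\cdot3\cdots(2k-1)$, $(-1)!!=1$. $\mathbb C^N$ has orthonormal basis $\tilde e_1,\dots,\tilde e_N$. Formal variables $\mathbf T=\{T^a_k\}_{1\le a\le N,\,k\ge0}$, $\mathbf T^a=\{T^a_k\}_{k\ge0}$; $T_k^a$ and $\partial/\partial T_k^a$ are $0$ for $k<0$. Operators are (formal completions of) differential operators acting on $\mathbb C[\mathbf T][[\hbar]]$ (with a possible factor $\hbar^{-1}$). Put $\widehat J^a_k=(2k-1)!!\,\partial/\partial T^a_{k-1}$ for $k>0$ and $\widehat J^a_k=T^a_{|k|}/(2|k|-1)!!$ for $k\le0$. Virasoro operators in one family $\{T_k\}_{k\ge 0}$: $$\widehat L_m=\tfrac12\sum_{i+j=-m-1}\frac{T_iT_j}{(2i-1)!!(2j-1)!!}+\sum_{k\ge0}\frac{(2k+2m+1)!!}{(2k-1)!!}T_k\frac{\partial}{\partial T_{k+m}}+\tfrac12\sum_{i+j=m-1}(2i+1)!!(2j+1)!!\frac{\partial^2}{\partial T_i\partial T_j};$$ $\widehat L_m(\mathbf T^a)$ is this operator in the variables $\mathbf T^a$. Givental operator. Write $r(z)=\sum_{k\ge1}r_kz^k$, $r_k\tilde e_a=\sum_b(r_k)^b_a\tilde e_b$, $(r_k)^{ab}=(r_k)_a^b$. Then $$\widehat R=\exp\Big(\sum_{k\ge1}\sum_{a,b}\Big(\sum_{j\ge0}(r_k)^b_aT^a_j\frac{\partial}{\partial T^b_{k+j}}+\tfrac12\sum_{j=0}^{k-1}(-1)^{j+1}(r_k)^{ab}\frac{\partial^2}{\partial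 T^a_j\partial T^b_{k-j-1}}\Big)\Big).$$ No symplectic condition on $R$ is assumed. Associated Virasoro operators: $\widehat L^a_m=\widehat R\,\widehat\Lambda^a_m\,\widehat R^{-1}$ with $$\widehat\Lambda^a_m=\tfrac12\widehat L_m(\mathbf T^a)-\frac{(2m+2\alpha_a+1)!!}{2\hbar\sqrt{\Delta_a}}\frac{\partial}{\partial T^a_{m+\alpha_a}}+\frac1{2\hbar}\sum_{k\ge1+\alpha_a}\frac{(2m+2k+1)!!}{(2k-1)!!}\Delta T^a_k\frac{\partial}{\partial T^a_{m+k}}+\frac{\delta_{m,0}}{16}.$$ Virasoro group element. For each $a$ let $v^a(z)=\sqrt{\Delta_a}\sum_{k\ge1+\alpha_a}\frac{\Delta T^a_k}{(2k+1)!!}z^{2k+1}$ and $f^a(z)=z\big(1-(2\alpha_a+1)v^a(z)/z^{2\alpha_a+1}\big)^{1/(2\alpha_a+1)}\in z+z^3\mathbb C[[z^2]]$. Let $\chi^a_k$ ($k\ge1$) be the unique constants with $f^a(z)=\exp\big(-\sum_{k\ge1}\chi_k^az^{2k+1}\frac{\partial}{\partial z}\big)\cdot z$. Then $\widehat V=\prod_{a=1}^N\exp\big(\sum_{k\ge1}\chi^a_k\widehat L_k(\mathbf T^a)\big)$. Deformed dimension operator: $\widehat H=\widehat R\,\widehat V\big(\sum_{a=1}^N\frac{\widehat L_0(\mathbf T^a)}{2\alpha_a+1}\big)\widehat V^{-1}\widehat R^{-1}$. *)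

(* Defs.v *)
From HB Require Import structures.
From mathcomp Require Import all_boot all_order all_algebra.
From mathcomp Require Import finmap.
From mathcomp Require Import monalg.
From mathcomp Require Import mathcomp_extra boolp classical_sets functions.
From mathcomp Require Import cardinality fsbigop reals complex.

Set Implicit Arguments.
Unset Strict Implicit.
Unset Printing Implicit Defensive.

Import Order.TTheory GRing.Theory Num.Theory.

Local Open Scope classical_set_scope.
Local Open Scope ring_scope.

(* All sums over infinite sets below are finitely supported sums              *)
(* \sum_(i \in D) _ of fsbigop, which are 0 by convention on an infinite      *)
(* support.  Every operator in this file is locally finite: applied to a      *)
(* polynomial (or read off at one coefficient of a power series) its infinite *)
(* sums have only finitely many nonzero terms.                                *)

(* n!! for odd n >= -1, so that (-1)!! = 1; meaningless for other n. *)
Definition dfact (F : fieldType) (n : int) : F :=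
  if n is Posz n' then \prod_(i < n'.+1 | odd i) i%:R else 1.

Section PowerSeries.

Variable F : fieldType.

(* An element of F[[z]], as its sequence of coefficients. *)
Definition fps := nat -> F.

Definition fps_one : fps := fun n => (n == 0)%N%:R.
Definition fps_z : fps := fun n => (n == 1)%N%:R.
Definition fps_mul (f g : fps) : fps :=
  fun n => \sum_(i < n.+1) f i * g (n - i)%N.
Definition fps_exp (f : fps) (p : nat) : fps := iter p (fps_mul f) fps_one.
Definition fps_deriv (f : fps) : fps := fun n => n.+1%:R * f n.+1.
Definition fps_mulXn (m : nat) (f : fps) : fps :=
  fun n => if (m <= n)%N then f (n - m)%N else 0.
(* f(z) / z^m, for f divisible by z^m. *)
Definition fps_divXn (m : nat) (f : fps) : fps := fun n => f (n + m)%N.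

Definition gbinom (s : F) (p : nat) : F :=
  (\prod_(i < p) (s - i%:R)) / p`!%:R.

(* (1 + f(z))^s, by the binomial series, for f without constant term. *)
Definition fps_pow1 (s : F) (f : fps) : fps :=
  fun n => \sum_(p \in [set: nat]) gbinom s p * fps_exp f p n.

(* exp(D) . f, for D : F[[z]] -> F[[z]] strictly increasing the z-adic order. *)
Definition fps_flow (D : fps -> fps) (f : fps) : fps :=
  fun n => \sum_(p \in [set: nat]) p`!%:R^-1 * iter p D f n.

(* The vector field - \sum_(k >= 1) chi_k z^(2k+1) d/dz. *)
Definition odd_field (chi : nat -> F) (f : fps) : fps :=
  fun n => - \sum_(k \in [set k | (1 <= k)%N])
               chi k * fps_mulXn (2 * k + 1) (fps_deriv f) n.

(* v(z), with s = sqrt Delta. *)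
Definition vser (alpha : nat) (s : F) (DeltaT : nat -> F) : fps :=
  fun n => s * \sum_(k \in [set k | (1 + alpha <= k)%N])
    DeltaT k / dfact F (2 * k%:Z + 1) * (n == 2 * k + 1)%N%:R.

(* f(z) = z (1 - (2 alpha + 1) v(z) / z^(2 alpha + 1))^(1 / (2 alpha + 1)). *)
Definition fser (alpha : nat) (s : F) (DeltaT : nat -> F) : fps :=
  let d := (2 * alpha + 1)%N in
  fps_mulXn 1 (fps_pow1 d%:R^-1
    (fun n => - (d%:R * fps_divXn d (vser alpha s DeltaT) n))).

End PowerSeries.

Section Operators.

Variables (F : fieldType) (N : nat).

(* F[T], the polynomials in the variables T^a_k, indexed by pairs (a, k). *)
Definition Tpoly : Type := {malg F[{cmonom ('I_N * nat)%type}]}.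
HB.instance Definition _ := GRing.ComAlgebra.on Tpoly.

Definition Top : Type := Tpoly -> Tpoly.
HB.instance Definition _ := GRing.Lmodule.on Top.

Definition mulT (a : 'I_N) (k : int) : Top := fun p =>
  if k is Posz n then << ucm (a, n) >> * p else 0.

Definition diffT (a : 'I_N) (k : int) : Top := fun p =>
  if k is Posz n then
    \sum_(m <- msupp p) << p@_m *+ m (a, n) *g divcm m (ucm (a, n)) >>
  else 0.

Definition opsum (I : choiceType) (D : set I) (A : I -> Top) : Top :=
  fun p => \sum_(i \in D) A i p.

(* exp(A), for A locally nilpotent. *)
Definition opexp (A : Top) : Top :=
  opsum [set: nat] (fun n => n`!%:R^-1 *: iter n A).

(* The inverse of a bijective operator. *)
Definition opinv (A : Top) : Top := 'pinv_(fun=> 0) [set: Tpoly] A.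

Definition Jop (a : 'I_N) (k : int) : Top :=
  if 0 < k then dfact F (2 * k - 1) *: diffT a (k - 1)
  else (dfact F (2 * `|k| - 1))^-1 *: mulT a `|k|.

(* \hat L_m(T^a). *)
Definition Lop (a : 'I_N) (m : int) : Top :=
  2^-1 *: opsum [set ij : int * int | ij.1 + ij.2 = - m - 1] (fun ij =>
    (dfact F (2 * ij.1 - 1) * dfact F (2 * ij.2 - 1))^-1 *:
      (mulT a ij.1 \o mulT a ij.2))
  + opsum [set: nat] (fun k =>
      (dfact F (2 * k%:Z + 2 * m + 1) / dfact F (2 * k%:Z - 1)) *:
        (mulT a k \o diffT a (k%:Z + m)))
  + 2^-1 *: opsum [set ij : int * int | ij.1 + ij.2 = m - 1] (fun ij =>
      (dfact F (2 * ij.1 + 1) * dfact F (2 * ij.2 + 1)) *: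
        (diffT a ij.1 \o diffT a ij.2)).

(* The exponent of the Givental operator.  The matrices r k act on column     *)
(* vectors: (r_k)^b_a = (r_k)^(ab) is the entry r k b a.                      *)
Definition givental_log (r : nat -> 'M[F]_N) : Top :=
  opsum [set k : nat | (1 <= k)%N] (fun k => \sum_(a < N) \sum_(b < N)
    (opsum [set: nat] (fun j =>
       r k b a *: (mulT a j \o diffT b (k%:Z + j%:Z)))
     + 2^-1 *: \sum_(j < k) ((-1) ^+ j.+1 * r k b a) *:
       (diffT a j%:Z \o diffT b (k%:Z - j%:Z - 1)))).

Definition Rop (r : nat -> 'M[F]_N) : Top := opexp (givental_log r).

(* The factors commute, so the order of composition is irrelevant. *)
Definition Vop (chi : 'I_N -> nat -> F) : Top :=
  \big[(fun A B : Top => A \o B)/idfun]_(a < N)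
    opexp (opsum [set k : nat | (1 <= k)%N] (fun k => chi a k *: Lop a k)).

Definition Hop (alpha : 'I_N -> nat) (r : nat -> 'M[F]_N)
    (chi : 'I_N -> nat -> F) : Top :=
  Rop r \o Vop chi
  \o (\sum_(a < N) (2 * alpha a + 1)%N%:R^-1 *: Lop a 0)
  \o opinv (Vop chi) \o opinv (Rop r).

Definition Wop (A : 'I_N -> 'I_N -> 'I_N -> int -> int -> int -> F)
    (B : 'I_N -> int -> F) : Top :=
  \sum_(a < N) \sum_(b < N) \sum_(c < N)
    opsum [set ijk : int * int * int |
             let: (i, j, k) := ijk in [/\ i <= j, j <= k & 0 <= i + j + k]]
      (fun ijk => let: (i, j, k) := ijk in
         A a b c i j k *: (Jop a i \o Jop b j \o Jop c k))
  + \sum_(a < N) opsum [set j : int | -1 <= j] (fun j => B a j *: Jop a j).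

(* Formal series \sum_(n : int) h_n hbar^n with coefficients in F[T]; an      *)
(* element of F[T][[hbar]] is a sequence nat -> Tpoly.                        *)
Definition hser : Type := int -> Tpoly.
HB.instance Definition _ := GRing.Lmodule.on hser.
Definition hop : Type := hser -> hser.
HB.instance Definition _ := GRing.Lmodule.on hop.

Definition hser_of (Z : nat -> Tpoly) : hser :=
  fun n => if n is Posz n' then Z n' else 0.

Definition hlift (A : Top) : hop := fun h n => A (h n).
Definition hinv : hop := fun h n => h (n + 1).
Definition hbar : hop := fun h n => h (n - 1).
Definition hdiff : hop := fun h n => (n + 1)%:~R *: h (n + 1).

Definition Lambda (alpha : 'I_N -> nat) (s : 'I_N -> F)
    (DeltaT : 'I_N -> nat -> F) (a : 'I_N) (m : int) : hop :=
  2^-1 *: hlift (Lop a m)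
  - (dfact F (2 * m + 2 * (alpha a)%:Z + 1) / (2 * s a)) *:
      (hinv \o hlift (diffT a (m + (alpha a)%:Z)))
  + 2^-1 *: (hinv \o hlift (opsum [set k : nat | (1 + alpha a <= k)%N] (fun k =>
      (dfact F (2 * m + 2 * k%:Z + 1) / dfact F (2 * k%:Z - 1) * DeltaT a k) *:
        diffT a (m + k%:Z))))
  + ((m == 0)%:R / 16) *: idfun.

(* The associated Virasoro operators \hat L^a_m. *)
Definition Vir (alpha : 'I_N -> nat) (r : nat -> 'M[F]_N) (s : 'I_N -> F)
    (DeltaT : 'I_N -> nat -> F) (a : 'I_N) (m : int) : hop :=
  hlift (Rop r) \o Lambda alpha s DeltaT a m \o hlift (opinv (Rop r)).

End Operators.

(* Main.v *)
(* The odd weight 2k + 1 of T_k makes J_i homogeneous of degree 1 - 2i, so both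
   the index condition and the parity of the degree become one condition on
   weights: an operator is of the form W' exactly when it is cubic (fourfold
   commutators with the generators J vanish) and raises weights by an odd amount
   at most 3.  Both conditions are stable under conjugation by the exponential of
   a quadratic operator G lowering weights, because e^G X e^(-G) is the sum of the
   ad_G^n(X) / n! and ad_G preserves them.

   Put Y = R^(-1) Z.  The dimension constraint reads hbar dY/dhbar = Q Y with
   Q = V (sum_a L_0(T^a) / (2 alpha_a + 1)) V^(-1) quadratic, not raising weights
   and annihilating 1, so that Q = sum_x U_x d_x with U_x linear in J.  The
   Virasoro constraints, once the dilaton power series in front of the
   derivatives is inverted, give d_x Y = hbar K_x Y with K_x quadratic.  Therefore
   dY/dhbar = (sum_x U_x K_x) Y, and R (sum_x U_x K_x) R^(-1) is cubic and raises
   weights by at most 3, since alpha_a <= 1. *)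

(* The obstacle is that all operators are infinite series, whose explicit coefficients would have to
   be normally ordered after each product or conjugation. Measuring order by iterated commutators
   avoids this: closure properties follow from the Leibniz and Jacobi rules, and coefficients are
   read off only once, at the end, from commutators with three generators. Equality on the Fock
   space is tested by one criterion: a linear operator commuting with all multiplications by
   variables and killing 1 is zero.

   The weight bound has a second use. A vector has bounded weight, so an operator that lowers
   weights far enough kills it; this makes the exponentials and the inverted series locally finite.

   Parity removes the quadratic and constant terms of W', because the commutators that detect them
   are scalars, and a nonzero scalar cannot shift weights by an odd amount.

   Powers of hbar enter only as a shift of index: the constraints express the derivatives of
   coefficient n + 1 of Y through coefficient n. *)
Require Import Defs.
From mathcomp Require Import all_boot all_order all_algebra.
From mathcomp Require Import finmap monalg.
From mathcomp Require Import mathcomp_extra boolp classical_sets functions.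
From mathcomp Require Import cardinality fsbigop reals complex zify ring.

Set Implicit Arguments.
Unset Strict Implicit.
Unset Printing Implicit Defensive.

Import Order.TTheory GRing.Theory Num.Theory.

Local Open Scope classical_set_scope.
Local Open Scope ring_scope.

(** * Monomials and their weights *)

Declare Scope cm_scope.
Delimit Scope cm_scope with M.
Local Notation "1" := (@mone _) : cm_scope.
Local Notation "x * y" := (mmul x y) : cm_scope.

Section Monomials.

Variable N : nat.
Local Notation mon := {cmonom ('I_N * nat)%type}.
Implicit Types (m : mon) (x y : 'I_N * nat).

Definition wt m : nat := (\sum_(x <- finsupp m) (2 * x.2 + 1) * m x)%N.

Lemma wtEw m (d : {fset ('I_N * nat)%type}) : (finsupp m `<=` d)%fset ->
  wt m = (\sum_(x <- d) (2 * x.2 + 1) * m x)%N.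
Proof.
move=> le; rewrite /wt (big_fset_incl _ le) //.
by move=> i _; rewrite -cmE_neq0 negbK => /eqP ->; rewrite muln0.
Qed.

Lemma wt1 : wt 1%M = 0%N.
Proof. by rewrite /wt mdom1 big_seq_fset0. Qed.

Lemma wtU x : wt (ucm x) = (2 * x.2 + 1)%N.
Proof. by rewrite /wt mdomU big_seq_fset1 cmUU muln1. Qed.

Lemma wtM m1 m2 : wt (m1 * m2)%M = (wt m1 + wt m2)%N.
Proof.
rewrite (wtEw (d := (finsupp m1 `|` finsupp m2)%fset)) ?mdomD ?fsubset_refl //.
rewrite (wtEw (fsubsetUl _ (finsupp m2))) (wtEw (fsubsetUr (finsupp m1) _)).
by rewrite -big_split /=; apply/eq_bigr=> /= i _; rewrite cmM mulnDr.
Qed.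

Lemma divcmK m x : m x != 0%N -> (ucm x * divcm m (ucm x))%M = m.
Proof.
move=> mx; apply/eqP/cmP => i; rewrite cmM divcmE cmU.
by case: (eqVneq x i) => [<-|_]; rewrite ?subn0 // subnKC // lt0n.
Qed.

Lemma ucmMK m x : divcm (ucm x * m)%M (ucm x) = m.
Proof. by apply/eqP/cmP => i; rewrite divcmE cmM addKn. Qed.

Lemma ucmMI x : injective (fun m => (ucm x * m)%M).
Proof. by move=> m m' e; rewrite -(ucmMK m x) e ucmMK. Qed.

Lemma ucmM_eq x m m' : (ucm x * m == ucm x * m')%M = (m == m').
Proof. exact: (inj_eq (@ucmMI x)). Qed.

Lemma cmonom_ind (P : mon -> Prop) :
  P 1%M -> (forall x m, P m -> P (ucm x * m)%M) -> forall m, P m.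
Proof.
move=> P1 PU m; have [n] := ubnP (mdeg m); elim: n m => // n IH m le.
have [/eqP ->//|m1] := boolP (m == 1%M).
have [x mx] : exists x, m x != 0%N.
  apply: contrapT => h; case/eqP: m1; apply/eqP/cmP => x; rewrite cm1.
  by apply/eqP/negPn/negP => hx; apply: h; exists x.
rewrite -(divcmK mx); apply: PU; apply: IH.
by move: le; rewrite -{1}(divcmK mx) mdegM mdegU add1n ltnS.
Qed.

End Monomials.

Section Weyl.

Variables (F : fieldType) (N : nat).
Local Notation mon := {cmonom ('I_N * nat)%type}.
Local Notation Tpoly := (Tpoly F N).
Local Notation Top := (Top F N).
Implicit Types (m : mon) (x y : 'I_N * nat) (p q : Tpoly) (A B C : Top).

Lemma mcoeff_sum_delta p m :
  \sum_(k <- msupp p) p@_k *+ (k == m) = p@_m.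
Proof.
by rewrite {3}[p]monalgE raddf_sum /=; apply: eq_bigr => k _; rewrite mcoeffU.
Qed.

Lemma mcoeffUM x p m :
  (<< ucm x >> * p)@_m = if m x == 0%N then 0 else p@_(divcm m (ucm x)).
Proof.
rewrite mcoeffMl msuppU1 big_seq_fset1 mcoeffUU.
case: (eqVneq (m x) 0%N) => mx.
  rewrite big1 // => m' _; case: eqP => [e|]; last by rewrite mulr0n.
  by move: mx; rewrite -e cmM cmUU.
rewrite -mcoeff_sum_delta; apply: eq_bigr => k _.
by rewrite mul1r -{1}(divcmK mx) ucmM_eq.
Qed.

Lemma mcoeff_mulT a n p m :
  (mulT a (Posz n) p)@_m = if m (a, n) == 0%N then 0 else p@_(divcm m (ucm (a, n))).
Proof. exact: mcoeffUM. Qed.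

Lemma mcoeff_diffT a n p m :
  (diffT a (Posz n) p)@_m = p@_(ucm (a, n) * m)%M *+ (m (a, n)).+1.
Proof.
rewrite /diffT raddf_sum /= -[RHS]mulr_natr -mcoeff_sum_delta mulr_suml.
apply: eq_bigr => k _; rewrite mcoeffU.
have [->|ne] := eqVneq k (ucm (a, n) * m)%M.
  by rewrite ucmMK eqxx mulr1n cmM cmUU add1n mulr_natr.
rewrite mulr0n mul0r; case: eqP => [e|]; last by rewrite mulr0n.
have [->|mx] := eqVneq (k (a, n)) 0%N; first by rewrite mulr0n.
by rewrite -(divcmK mx) e eqxx in ne.
Qed.

End Weyl.

(** * Linear operators and locally finite sums *)

Section LinearOperators.

Variables (F : fieldType) (V : lmodType F).
Implicit Types (A B C : V -> V) (u v w : V).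

Definition lin A := forall c u v, A (c *: u + v) = c *: A u + A v.

Lemma linD A u v : lin A -> A (u + v) = A u + A v.
Proof. by move=> lA; have := lA 1 u v; rewrite !scale1r. Qed.

Lemma lin0 A : lin A -> A 0 = 0.
Proof. by move=> lA; apply: (addIr (A 0)); rewrite -(linD _ _ lA) !add0r. Qed.

Lemma linZ A c v : lin A -> A (c *: v) = c *: A v.
Proof. by move=> lA; have := lA c v 0; rewrite (lin0 lA) !addr0. Qed.

Lemma linN A v : lin A -> A (- v) = - A v.
Proof. by move=> lA; rewrite -scaleN1r linZ // scaleN1r. Qed.

Lemma linB A u v : lin A -> A (u - v) = A u - A v.
Proof. by move=> lA; rewrite linD // linN. Qed.

Lemma lin_sum A (I : Type) (r : seq I) (P : pred I) (f : I -> V) :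
  lin A -> A (\sum_(i <- r | P i) f i) = \sum_(i <- r | P i) A (f i).
Proof.
by move=> lA; apply: (big_morph A) => [u v|]; [exact: linD|exact: lin0].
Qed.

Lemma lin_id : lin id. Proof. by []. Qed.

Lemma lin_comp A B : lin A -> lin B -> lin (A \o B).
Proof. by move=> lA lB c u v /=; rewrite lB lA. Qed.

Lemma lin_zero : lin (fun=> 0).
Proof. by move=> c u v; rewrite scaler0 addr0. Qed.

Lemma lin_add A B : lin A -> lin B -> lin (fun v => A v + B v).
Proof.
by move=> lA lB c u v; rewrite lA lB scalerDr !addrA; congr (_ + _); rewrite addrAC.
Qed.

Lemma lin_scale k A : lin A -> lin (fun v => k *: A v).
Proof. by move=> lA c u v; rewrite lA scalerDr !scalerA mulrC. Qed.

Lemma lin_sub A B : lin A -> lin B -> lin (fun v => A v - B v).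
Proof.
move=> lA lB c u v; rewrite lA lB scalerBr opprD !addrA.
by congr (_ + _); rewrite addrAC.
Qed.

Lemma lin_bigsum (I : Type) (r : seq I) (A : I -> V -> V) :
  (forall i, lin (A i)) -> lin (fun v => \sum_(i <- r) A i v).
Proof.
by move=> lA c u v; rewrite scaler_sumr -big_split; apply: eq_bigr => i _; apply: lA.
Qed.

Lemma lin_iter n A : lin A -> lin (iter n A).
Proof. by move=> lA; elim: n => [|n IH] c u v //=; rewrite IH lA. Qed.

Definition comm A B := fun v => A (B v) - B (A v).

Lemma lin_comm A B : lin A -> lin B -> lin (comm A B).
Proof. by move=> lA lB; apply: lin_sub; apply: lin_comp. Qed.

Lemma jacobi A B C : lin A -> lin B -> lin C ->
  comm (comm A B) C = (fun v => comm (comm A C) B v + comm A (comm B C) v).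
Proof.
move=> lA lB lC; apply/funext => v; rewrite /comm.
rewrite (linB _ _ lA) (linB _ _ lB) (linB _ _ lC) !opprB.
rewrite [RHS]addrACA.
have tri (x y z : V) : x - y + (z - x) = z - y by rewrite addrC addrA subrK.
rewrite !tri [LHS]addrAC [RHS]addrA; congr (_ - _).
by rewrite [LHS]addrA [LHS]addrAC.
Qed.

Lemma comm_mull A B C : lin A ->
  comm (A \o B) C = (fun v => A (comm B C v) + comm A C (B v)).
Proof.
by move=> lA; apply/funext => v; rewrite /comm /= (linB _ _ lA) addrA subrK.
Qed.

Lemma comm_addl A B C : lin C ->
  comm (fun v => A v + B v) C = (fun v => comm A C v + comm B C v).
Proof.
by move=> lC; apply/funext => v; rewrite /comm (linD _ _ lC) opprD addrACA.
Qed.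

Lemma comm_scalel k A C : lin C ->
  comm (fun v => k *: A v) C = (fun v => k *: comm A C v).
Proof. by move=> lC; apply/funext => v; rewrite /comm (linZ _ _ lC) scalerBr. Qed.

Lemma comm_scalarl k A : lin A -> comm (fun v => k *: v) A = (fun=> 0).
Proof. by move=> lA; apply/funext => v; rewrite /comm (linZ _ _ lA) subrr. Qed.

Lemma comm_scalarr k A : lin A -> comm A (fun v => k *: v) = (fun=> 0).
Proof. by move=> lA; apply/funext => v; rewrite /comm (linZ _ _ lA) subrr. Qed.

Lemma comm_zerol A : lin A -> comm (fun=> 0) A = (fun=> 0).
Proof. by move=> lA; apply/funext => v; rewrite /comm (lin0 lA) subrr. Qed.

Lemma comm_zeror A : lin A -> comm A (fun=> 0) = (fun=> 0).
Proof. by move=> lA; apply/funext => v; rewrite /comm (lin0 lA) subrr. Qed.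

Lemma comm0_apply A B v : lin B -> comm A B = (fun=> 0) -> A v = 0 -> A (B v) = 0.
Proof.
move=> lB /(congr1 (fun f : V -> V => f v)); rewrite /comm => e Av.
by move: e; rewrite Av (lin0 lB) subr0.
Qed.

Section InfiniteSums.

Variable I : choiceType.
Implicit Types (D : set I) (f : I -> V -> V).

Definition lsum D f : V -> V := fun v => \sum_(i \in D) f i v.

(** A sum with infinite support is 0 by convention, so without this condition [lsum] need be neither
    additive nor compatible with commutators. *)
Definition locfin D f := forall v, finite_set [set i | D i /\ f i v <> 0].

Lemma fsum_seq (D : set I) (s : seq I) (g : I -> V) : uniq s ->
  (forall i, i \in s -> D i) -> (forall i, D i -> i \notin s -> g i = 0) ->
  \sum_(i \in D) g i = \sum_(i <- s) g i.
Proof.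
move=> us sD h; rewrite (@fsbigE _ _ _ _ D s) //.
by rewrite big_seq_cond [RHS]big_seq; apply: eq_bigl => i; case is_: (i \in s);
  rewrite //= mem_set //; apply: sD.
Qed.

(** One list serves several vectors at once: linearity compares the sums at [u], [v] and
    [c *: u + v], a commutator those at [v] and [B v]. *)
Lemma locfin_seq D f (vs : seq V) : locfin D f ->
  exists s : seq I, [/\ uniq s, forall i, i \in s -> D i &
    forall v i, v \in vs -> D i -> i \notin s -> f i v = 0].
Proof.
move=> lf.
have [X [fX XD h]] : exists X : set I, [/\ finite_set X, X `<=` D &
    forall v i, v \in vs -> D i -> ~ X i -> f i v = 0].
  elim: vs => [|v vs [X [fX XD h]]].
    by exists set0; split=> //; exact: finite_set0.
  exists (X `|` [set i | D i /\ f i v <> 0]); split.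
  - by rewrite finite_setU; split.
  - by move=> i [/XD|[]].
  - move=> u i; rewrite in_cons => /orP[/eqP ->|us] Di nX.
      by apply: contrapT => fi; apply: nX; right.
    by apply: h => // Xi; apply: nX; left.
exists (fset_set X); split; first exact: fset_uniq.
  by move=> i; rewrite in_fset_set // => /set_mem /XD.
move=> v i vs_ Di; rewrite in_fset_set // => nX; apply: h => // Xi.
by move: nX; rewrite mem_set.
Qed.

Lemma lin_lsum D f : locfin D f -> (forall i, D i -> lin (f i)) -> lin (lsum D f).
Proof.
move=> lf lA c u v; have [s [us sD h]] := locfin_seq [:: u; v; c *: u + v] lf.
rewrite /lsum !(fsum_seq us sD); first last.
- by move=> i Di is_; apply: h; rewrite ?inE ?eqxx ?orbT.
- by move=> i Di is_; apply: h; rewrite ?inE ?eqxx ?orbT.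
- by move=> i Di is_; apply: h; rewrite ?inE ?eqxx ?orbT.
by rewrite scaler_sumr -big_split; apply: eq_big_seq => i is_; apply: lA; apply: sD.
Qed.

Lemma locfin_comm D f B : lin B -> locfin D f -> locfin D (fun i => comm (f i) B).
Proof.
move=> lB lf v; have := conj (lf (B v)) (lf v); rewrite -finite_setU.
apply: sub_finite_set => i [Di ne] /=; apply: contrapT => /not_orP[n1 n2].
apply: ne; rewrite /comm.
have -> : f i v = 0 by apply: contrapT => e; apply: n2.
by rewrite (lin0 lB) subr0; apply: contrapT => e; apply: n1.
Qed.

Lemma comm_lsum D f B : lin B -> locfin D f ->
  comm (lsum D f) B = lsum D (fun i => comm (f i) B).
Proof.
move=> lB lf; apply/funext => v; have [s [us sD h]] := locfin_seq [:: B v; v] lf.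
have h1 i : D i -> i \notin s -> f i (B v) = 0.
  by move=> Di is_; apply: h; rewrite ?inE ?eqxx ?orbT.
have h2 i : D i -> i \notin s -> f i v = 0.
  by move=> Di is_; apply: h; rewrite ?inE ?eqxx ?orbT.
rewrite /comm /lsum !(fsum_seq us sD) //; last first.
  by move=> i Di is_; rewrite h1 // h2 // (lin0 lB) subrr.
by rewrite (lin_sum _ _ _ lB) sumrB.
Qed.

Lemma lsum_add D f g v : locfin D f -> locfin D g ->
  lsum D (fun i v => f i v + g i v) v = lsum D f v + lsum D g v.
Proof.
move=> lf lg; have [s [us sD h]] : exists s : seq I, [/\ uniq s,
    forall i, i \in s -> D i & forall i, D i -> i \notin s -> f i v = 0 /\ g i v = 0].
  have fin := conj (lf v) (lg v); rewrite -finite_setU in fin.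
  set X := _ `|` _ in fin; exists (fset_set X); split; first exact: fset_uniq.
    by move=> i; rewrite in_fset_set // => /set_mem [[]|[]].
  move=> i Di; rewrite in_fset_set // => nX.
  by split; apply: contrapT => ne; move/negP: nX; apply; rewrite inE; [left|right].
rewrite /lsum !(fsum_seq us sD) ?big_split //.
- by move=> i Di is_; have [] := h i Di is_.
- by move=> i Di is_; have [] := h i Di is_.
- by move=> i Di is_; have [-> ->] := h i Di is_; rewrite addr0.
Qed.

Lemma fsum_single (g : I -> V) i0 :
  (forall i, i != i0 -> g i = 0) -> \sum_(i \in [set: I]) g i = g i0.
Proof.
move=> g0; rewrite (@fsum_seq _ [:: i0]) ?big_seq1 // => i _.
by rewrite inE; apply: g0.
Qed.

End InfiniteSums.

End LinearOperators.

(** * Weight and order of operators on a Fock space *)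

Section FockSpace.

Variables (F : fieldType) (V : lmodType F) (N : nat).
Variables (one : V) (gen : 'I_N * int -> V -> V) (Fil : int -> V -> Prop).

Implicit Types (A B C X Y : V -> V) (u v : V) (w : int) (x y z : 'I_N * int).

(** In the polynomial model T_k has index -k and its derivative index k + 1, so dual indices add up
    to 1, not 0. The value is 1 when the derivative stands on the left. *)
Definition omega x y : F :=
  if (x.1 == y.1) && (x.2 + y.2 == 1) then if 0 < x.2 then 1 else -1 else 0.

(* Fil w is spanned by the monomials of weight <= w and = w mod 2, where T_k
   has weight 2k + 1; the parity of the weight is that of the degree. *)
Record fock : Prop := Fock {
  fock_lin : forall x, lin (gen x);
  fock_comm : forall x y, comm (gen x) (gen y) = (fun v => omega x y *: v);
  fock_cyclic : forall A, lin A ->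
    (forall a (n : nat), comm A (gen (a, - n%:Z)) = (fun=> 0)) -> A one = 0 ->
    A = (fun=> 0);
  fock_const : forall v, (forall a (n : nat), gen (a, n.+1%:Z) v = 0) ->
    exists c, v = c *: one;
  fock_one : one <> 0;
  Fil0 : forall w, Fil w 0;
  FilL : forall w c u v, Fil w u -> Fil w v -> Fil w (c *: u + v);
  FilS : forall w v, Fil w v -> Fil (w + 2) v;
  Fil_lt0 : forall w v, w < 0 -> Fil w v -> v = 0;
  Fil_gen : forall w x v, Fil w v -> Fil (w + (1 - 2 * x.2)) (gen x v);
  Fil_one : Fil 0 one;
  Fil_oneP : forall w, Fil w one -> exists k : nat, w = 2 * k%:Z;
  Fil_exhaust : forall v, exists (n : nat) v0 v1,
    [/\ v = v0 + v1, Fil n%:Z v0 & Fil n.+1%:Z v1] }.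

Hypothesis fk : fock.
Lemma lin_gen x : lin (gen x).
Proof. exact: fock_lin. Qed.
#[local] Hint Resolve lin_gen : core.

Lemma FilD w u v : Fil w u -> Fil w v -> Fil w (u + v).
Proof. by move=> hu hv; rewrite -[u]scale1r; apply: FilL. Qed.

Lemma FilZ w c v : Fil w v -> Fil w (c *: v).
Proof. by move=> hv; rewrite -[_ *: _]addr0; apply: FilL => //; apply: Fil0. Qed.

Lemma Fil_sum w (I : Type) (r : seq I) (f : I -> V) :
  (forall i, Fil w (f i)) -> Fil w (\sum_(i <- r) f i).
Proof. by move=> h; elim/big_ind: _ => //; [exact: Fil0|move=> *; exact: FilD]. Qed.

Lemma Fil_even w (k : nat) v : Fil w v -> Fil (w + 2 * k%:Z) v.
Proof.
elim: k => [|k IH] h; first by rewrite mulr0 addr0.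
have -> : w + 2 * k.+1%:Z = w + 2 * k%:Z + 2 by lia.
by apply: FilS => //; apply: IH.
Qed.

(** [e] bounds the weight shift from above and fixes its parity, so a bound may be relaxed only in
    steps of 2. *)
Definition Fop (e : int) A := forall w v, Fil w v -> Fil (w + e) (A v).

Lemma Fop_eq e f A : e = f -> Fop e A -> Fop f A. Proof. by move=> ->. Qed.

Lemma Fop_weaken e f A : (exists k : nat, f = e + 2 * k%:Z) -> Fop e A -> Fop f A.
Proof. by move=> [k ->] h w v hv; rewrite addrA; apply/Fil_even/h. Qed.

Lemma Fop_id : Fop 0 id.
Proof. by move=> w v; rewrite addr0. Qed.

Lemma Fop_zero e : Fop e (fun=> 0).
Proof. by move=> w v _; apply: Fil0. Qed.

Lemma Fop_add e A B : Fop e A -> Fop e B -> Fop e (fun v => A v + B v).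
Proof. by move=> hA hB w v hv; apply: FilD; [apply: hA|apply: hB]. Qed.

Lemma Fop_scale e k A : Fop e A -> Fop e (fun v => k *: A v).
Proof. by move=> hA w v hv; apply/FilZ/hA. Qed.

Lemma Fop_sub e A B : Fop e A -> Fop e B -> Fop e (fun v => A v - B v).
Proof.
by move=> hA hB w v hv; rewrite [_ - _]addrC -scaleN1r; apply: FilL => //;
  [apply: hB|apply: hA].
Qed.

Lemma Fop_comp e f A B : Fop e A -> Fop f B -> Fop (e + f) (A \o B).
Proof. by move=> hA hB w v hv; rewrite (addrC e) addrA; apply/hA/hB. Qed.

Lemma Fop_comm e f A B : Fop e A -> Fop f B -> Fop (e + f) (comm A B).
Proof.
by move=> hA hB; apply: Fop_sub; [|rewrite (addrC e)]; apply: Fop_comp.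
Qed.

Lemma Fop_sum e (I : Type) (r : seq I) (f : I -> V -> V) :
  (forall i, Fop e (f i)) -> Fop e (fun v => \sum_(i <- r) f i v).
Proof. by move=> h w v hv; apply: Fil_sum => i; apply: h. Qed.

Lemma Fop_lsum e (I : choiceType) (D : set I) (f : I -> V -> V) :
  (forall i, D i -> Fop e (f i)) -> Fop e (lsum D f).
Proof.
move=> h w v hv; rewrite /lsum big_seq; elim/big_ind: _ => [||i].
- exact: Fil0.
- by move=> *; exact: FilD.
- by case: finite_supportP => // X XD _ _ /XD Di; apply: h.
Qed.

Lemma Fop_gen x : Fop (1 - 2 * x.2) (gen x).
Proof. by move=> w v; apply: Fil_gen. Qed.

(** The two parity parts of [v] have bounded weight; lowering by more than that bound lands below
    weight 0. This is the usual source of truncation bounds for series. *)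
Lemma Fop_vanish v : exists b : nat,
  forall A e, lin A -> Fop e A -> e < - b%:Z -> A v = 0.
Proof.
have [n [v0 [v1 [-> h0 h1]]]] := Fil_exhaust fk v; exists n.+1 => A e lA hA lt.
rewrite (linD _ _ lA).
rewrite (Fil_lt0 fk _ (hA _ _ h0)); last by lia.
by rewrite (Fil_lt0 fk _ (hA _ _ h1)) ?addr0 //; lia.
Qed.

Lemma gen_one a (n : nat) : gen (a, n.+1%:Z) one = 0.
Proof. by apply: (Fil_lt0 fk _ (Fil_gen fk (a, n.+1%:Z) (Fil_one fk))) => /=; lia. Qed.

(* Off by one: Ew d is order at most d - 1 in the generators, so that Ew 0 is {0}. *)
Fixpoint Ew (d : nat) A : Prop :=
  if d is d'.+1 then forall x, Ew d' (comm A (gen x)) else A = (fun=> 0).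

Lemma Ew_zero d : Ew d (fun=> 0).
Proof. by elim: d => [//|d IH] x; rewrite comm_zerol. Qed.

Lemma Ew_S d A : Ew d A -> Ew d.+1 A.
Proof.
elim: d A => [|d IH] A; last by move=> h x; apply: IH.
by move=> -> x; rewrite comm_zerol //; apply: Ew_zero.
Qed.

Lemma Ew_add d A B : Ew d A -> Ew d B -> Ew d (fun v => A v + B v).
Proof.
elim: d A B => [|d IH] A B /=.
  by move=> -> ->; apply/funext => v; rewrite addr0.
by move=> hA hB x; rewrite comm_addl //; apply: IH.
Qed.

Lemma Ew_scale d k A : Ew d A -> Ew d (fun v => k *: A v).
Proof.
elim: d A => [|d IH] A /=.
  by move=> ->; apply/funext => v; rewrite scaler0.
by move=> hA x; rewrite comm_scalel //; apply: IH.
Qed.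

Lemma Ew_sub d A B : Ew d A -> Ew d B -> Ew d (fun v => A v - B v).
Proof.
move=> hA hB; have -> : (fun v => A v - B v) = (fun v => A v + -1 *: B v).
  by apply/funext => v; rewrite scaleN1r.
exact/Ew_add/Ew_scale.
Qed.

Lemma Ew_lsum d (I : choiceType) (D : set I) (f : I -> V -> V) : locfin D f ->
  (forall i, D i -> Ew d (f i)) -> Ew d (lsum D f).
Proof.
elim: d f => [|d IH] f lf h.
  by apply/funext => v; rewrite /lsum fsbig1 // => i Di; rewrite (h i Di).
move=> x; rewrite comm_lsum //; apply: IH; first exact: locfin_comm.
by move=> i Di; apply: h.
Qed.

Lemma Ew_sum d (I : Type) (r : seq I) (f : I -> V -> V) :
  (forall i, Ew d (f i)) -> Ew d (fun v => \sum_(i <- r) f i v).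
Proof.
move=> h; elim: r => [|i r IH].
  by rewrite (_ : (fun v => _) = (fun=> 0)); [exact: Ew_zero|apply/funext => v; rewrite big_nil].
rewrite (_ : (fun v => _) = (fun v => f i v + \sum_(j <- r) f j v)).
  exact: Ew_add.
by apply/funext => v; rewrite big_cons.
Qed.

Lemma Ew_id : Ew 1 id.
Proof. by move=> x; apply/funext => v; rewrite /comm subrr. Qed.

Lemma Ew_gen x : Ew 2 (gen x).
Proof. by move=> y; rewrite (fock_comm fk); exact: (Ew_scale (omega x y) Ew_id). Qed.

(** A form of Schur's lemma. Annihilators commute with [A] and kill [one], hence kill [A one], which
    is therefore [c *: one]; then [A - c] commutes with the generators and kills the cyclic
    vector. *)
Lemma Ew_scalar A : lin A -> Ew 1 A -> exists c, A = (fun v => c *: v).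
Proof.
move=> lA EA; have [a n|c Ac] := fock_const fk (v := A one).
  have /= /(congr1 (fun B : V -> V => B one)) := EA (a, n.+1%:Z).
  by rewrite /comm gen_one (lin0 lA) sub0r => /eqP; rewrite oppr_eq0 => /eqP.
exists c; have : (fun v => A v - c *: v) = (fun=> 0).
  apply: (fock_cyclic fk).
  - by apply: lin_sub => //; apply: lin_scale; apply: lin_id.
  - move=> a n; have := Ew_sub EA (Ew_scale c Ew_id); apply.
  - by rewrite Ac subrr.
move=> h; apply/funext => v; apply/eqP; rewrite -subr_eq0; apply/eqP.
exact: (congr1 (fun B : V -> V => B v) h).
Qed.

(** A nonzero scalar neither lowers the weight of [one] nor changes its parity. Applied to iterated
    commutators, this turns the weight bound into the index conditions on the coefficients. *)
Lemma scalar_weight c e : Fop e (fun v => c *: v) -> c <> 0 ->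
  exists k : nat, e = 2 * k%:Z.
Proof.
move=> h /eqP c0; apply: (Fil_oneP fk); rewrite -[e]add0r.
rewrite -[one]scale1r -(mulVf c0) -scalerA.
by apply: FilZ; apply/h/Fil_one.
Qed.

(** By Jacobi, bracketing with a generator gives the bracket of a scalar with [X], which vanishes,
    plus the bracket of [A] with an operator of lower order. *)
Lemma Ew_comm_linear d A X : lin A -> Ew 2 A -> lin X -> Ew d.+1 X ->
  Ew d (comm A X).
Proof.
move=> lA EA; elim: d X => [|d IH] X lX EX.
  have [c ->] := Ew_scalar lX EX; exact: comm_scalarr.
move=> x; rewrite jacobi //; apply: Ew_add.
  have [c ->] := Ew_scalar (lin_comm lA (fock_lin fk x)) (EA x).
  by rewrite comm_scalarl //; apply: Ew_zero.
exact: (IH _ (lin_comm lX (lin_gen x)) (EX x)).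
Qed.

(** The bracket of a quadratic [A] with a generator is linear, so the first Jacobi term loses an
    order by the previous lemma; the second is covered by induction. This keeps cubic operators
    cubic under conjugation. *)
Lemma Ew_comm_quadratic d A X : lin A -> Ew 3 A -> lin X -> Ew d X ->
  Ew d (comm A X).
Proof.
move=> lA EA; elim: d X => [|d IH] X lX EX; first by rewrite EX comm_zeror.
move=> x; rewrite jacobi //; apply: Ew_add.
  exact: (Ew_comm_linear (lin_comm lA (lin_gen x)) (EA x) lX EX).
exact: (IH _ (lin_comm lX (lin_gen x)) (EX x)).
Qed.

Lemma Ew_comp a b A B : lin A -> lin B -> Ew a.+1 A -> Ew b.+1 B ->
  Ew (a + b).+1 (A \o B).
Proof.
(* Induction on the sum of the orders, because each Leibniz term lowers the order of only one
   factor. *)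
have [n] := ubnP (a + b)%N; elim: n a b A B => // n IH a b A B le lA lB EA EB.
case: a => [|a] in le EA *.
  by have [c ->] := Ew_scalar lA EA; apply: Ew_scale.
case: b => [|b] in le EB *.
  have [c ->] := Ew_scalar lB EB; rewrite addn0.
  rewrite (_ : _ \o _ = (fun v => c *: A v)); first exact: Ew_scale.
  by apply/funext => v /=; rewrite linZ.
move=> x; rewrite comm_mull //; apply: Ew_add.
  rewrite (_ : (a.+1 + b.+1)%N = (a.+1 + b).+1); last by lia.
  by apply: (IH a.+1 b _ _ _ lA (lin_comm lB (lin_gen x)) EA (EB x)); lia.
rewrite (_ : (a.+1 + b.+1)%N = (a + b.+1).+1); last by lia.
by apply: (IH a b.+1 _ _ _ (lin_comm lA (lin_gen x)) lB (EA x) EB); lia.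
Qed.

Lemma comm_gen_swap X x y : lin X ->
  comm (comm X (gen x)) (gen y) = comm (comm X (gen y)) (gen x).
Proof.
move=> lX; rewrite jacobi // (fock_comm fk x y) comm_scalarr //.
by apply/funext => v; rewrite addr0.
Qed.

Definition cls (d : nat) (e : int) A := [/\ lin A, Fop e A & Ew d A].

Lemma cls_weaken d e f A : (exists k : nat, f = e + 2 * k%:Z) -> cls d e A -> cls d f A.
Proof. by move=> h [lA fA eA]; split => //; apply: Fop_weaken h fA. Qed.

Lemma cls_eq d e f A : e = f -> cls d e A -> cls d f A. Proof. by move=> ->. Qed.

Lemma cls_S d e A : cls d e A -> cls d.+1 e A.
Proof. by case=> lA fA eA; split => //; apply: Ew_S. Qed.

Lemma cls_zero d e : cls d e (fun=> 0).
Proof. by split; [exact: lin_zero|exact: Fop_zero|exact: Ew_zero]. Qed.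

Lemma cls_id : cls 1 0 id.
Proof. by split; [exact: lin_id|exact: Fop_id|exact: Ew_id]. Qed.

Lemma cls_gen x : cls 2 (1 - 2 * x.2) (gen x).
Proof. by split; [exact: fock_lin|exact: Fop_gen|exact: Ew_gen]. Qed.

Lemma cls_add d e A B : cls d e A -> cls d e B -> cls d e (fun v => A v + B v).
Proof.
by move=> [lA fA eA] [lB fB eB]; split;
  [exact: lin_add|exact: Fop_add|exact: Ew_add].
Qed.

Lemma cls_scale d e k A : cls d e A -> cls d e (fun v => k *: A v).
Proof.
by move=> [lA fA eA]; split; [exact: lin_scale|exact: Fop_scale|exact: Ew_scale].
Qed.

Lemma cls_sub d e A B : cls d e A -> cls d e B -> cls d e (fun v => A v - B v).
Proof.
by move=> [lA fA eA] [lB fB eB]; split;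
  [exact: lin_sub|exact: Fop_sub|exact: Ew_sub].
Qed.

Lemma cls_sum d e (I : Type) (r : seq I) (f : I -> V -> V) :
  (forall i, cls d e (f i)) -> cls d e (fun v => \sum_(i <- r) f i v).
Proof.
move=> h; split; first by apply: lin_bigsum => i; case: (h i).
- by apply: Fop_sum => i; case: (h i).
- by apply: Ew_sum => i; case: (h i).
Qed.

Lemma cls_comp a b e f A B : cls a.+1 e A -> cls b.+1 f B ->
  cls (a + b).+1 (e + f) (A \o B).
Proof.
by move=> [lA fA eA] [lB fB eB]; split;
  [exact: lin_comp|exact: Fop_comp|exact: Ew_comp].
Qed.

Lemma cls_comm_gen d e A x : cls d.+1 e A -> cls d (e + (1 - 2 * x.2)) (comm A (gen x)).
Proof.
move=> [lA fA eA]; split; first exact: lin_comm.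
  by apply: Fop_comm => //; apply: Fop_gen.
exact: eA.
Qed.

Lemma cls_lsum d e (I : choiceType) (D : set I) (f : I -> V -> V) : locfin D f ->
  (forall i, D i -> cls d e (f i)) -> cls d e (lsum D f).
Proof.
move=> lf h; split; first by apply: lin_lsum => // i /h[].
- by apply: Fop_lsum => i /h[].
- by apply: Ew_lsum => // i /h[].
Qed.

Lemma locfin_weight (I : choiceType) (D : set I) (e : I -> int) (f : I -> V -> V) :
  (forall i, lin (f i)) -> (forall i, Fop (e i) (f i)) ->
  (forall b : nat, finite_set [set i | D i /\ - b%:Z <= e i]) -> locfin D f.
Proof.
move=> lf ff fin v; have [b hb] := Fop_vanish v; apply: sub_finite_set (fin b).
move=> i [Di ne]; split => //; rewrite leNgt; apply/negP => lt.
by apply: ne; apply: hb (lf i) (ff i) lt.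
Qed.

Lemma locfin_nat e (f : nat -> V -> V) (D : set nat) :
  (forall n, lin (f n)) -> (forall n, Fop (e - 2 * n%:Z) (f n)) -> locfin D f.
Proof.
move=> lf ff; apply: (locfin_weight lf ff) => b.
apply: (@sub_finite_set _ _ `I_((b + `|e|).+1)); last exact: finite_II.
by move=> n [_ /= le]; lia.
Qed.

(** The drift -2n serves twice: it makes the family locally finite and, being even, it relaxes to
    the common bound [e]. *)
Lemma cls_lsum_nat d e (f : nat -> V -> V) (D : set nat) :
  (forall n, cls d (e - 2 * n%:Z) (f n)) -> cls d e (lsum D f).
Proof.
move=> h; apply: cls_lsum.
  by apply: (@locfin_nat e) => n; case: (h n).
by move=> n _; apply: cls_weaken (h n); exists n; lia.
Qed.

End FockSpace.

(** * Exponentials *)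

Section CauchyProducts.

Lemma triangle_sum (W : zmodType) (K : nat) (f : nat -> nat -> W) :
  (forall i j, (K <= i + j)%N -> f i j = 0) ->
  \sum_(i < K) \sum_(j < K) f i j = \sum_(n < K) \sum_(i < n.+1) f i (n - i)%N.
Proof.
move=> f0.
rewrite [RHS](eq_bigr (fun n : 'I_K => \sum_(i < K | (i <= n)%N) f i (n - i)%N)).
  rewrite [RHS](exchange_big_dep xpredT) //=; apply: eq_bigr => i _.
  transitivity (\sum_(i <= n < K) f i (n - i)%N); last by rewrite big_geq_mkord.
  transitivity (\sum_(0 <= n < K - i) f i (n + i - i)%N); last first.
    by rewrite -(big_addn 0 K i xpredT (fun n => f i (n - i)%N)).
  rewrite -(big_mkord xpredT (f i)) (@big_cat_nat _ _ _ (K - i)%N) //=; last exact: leq_subr.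
  rewrite [X in _ + X]big_nat_cond [X in _ + X]big1 ?addr0.
    by apply: eq_bigr => j _; rewrite addnK.
  by move=> j /andP[/andP[le _] _]; apply: f0; rewrite -leq_subLR.
by move=> n _; rewrite (big_ord_widen_cond K xpredT (fun i => f i (n - i)%N)).
Qed.

Lemma fsum_nat (F : fieldType) (V : lmodType F) (K : nat) (g : nat -> V) :
  (forall n, (K <= n)%N -> g n = 0) -> \sum_(n \in [set: nat]) g n = \sum_(n < K) g n.
Proof.
move=> g0; rewrite (@fsum_seq _ _ _ _ (iota 0 K)) ?iota_uniq //.
  by rewrite -(big_mkord xpredT) /index_iota subn0.
by move=> n _; rewrite mem_iota add0n /= -leqNgt; apply: g0.
Qed.

End CauchyProducts.

Section Exponentials.

Variables (F : fieldType) (V : lmodType F) (N : nat).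
Variables (one : V) (gen : 'I_N * int -> V -> V) (Fil : int -> V -> Prop).
Hypothesis fk : fock one gen Fil.
Hypothesis F0 : forall n : nat, n.+1%:R != 0 :> F.
Local Notation cls := (cls gen Fil).
Local Notation Fop := (Fop Fil).
Implicit Types (G X : V -> V).

Lemma lsum_cauchy e f (A B : nat -> V -> V) :
  (forall n, lin (A n)) -> (forall n, lin (B n)) ->
  (forall n, Fop (e - 2 * n%:Z) (A n)) -> (forall n, Fop (f - 2 * n%:Z) (B n)) ->
  lsum [set: nat] A \o lsum [set: nat] B =
  lsum [set: nat] (fun n v => \sum_(i < n.+1) A i (B (n - i)%N v)).
Proof.
move=> lA lB fA fB; apply/funext => v; rewrite /lsum /=.
have [b hb] := Fop_vanish fk v.
(* Beyond [K] the weights e + f - 2(i + j) and f - 2j are below -b, so the double sum and the inner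
   sum both stop there. *)
pose K := (b + `|e| + `|f|).+1.
have AB i j : (K <= i + j)%N -> A i (B j v) = 0.
  move=> le; apply: (hb (A i \o B j) _ (lin_comp (lA i) (lB j)) (Fop_comp (fA i) (fB j))).
  by rewrite /K in le; lia.
have B0 j : (K <= j)%N -> B j v = 0.
  by move=> le; apply: (hb _ _ (lB j) (fB j)); rewrite /K in le; lia.
rewrite (fsum_nat B0) (@fsum_nat _ _ K); last first.
  by move=> i le; rewrite (lin_sum _ _ _ (lA i)) big1 // => j _; apply: AB; lia.
rewrite [RHS](@fsum_nat _ _ K); last first.
  by move=> n le; rewrite big1 // => i _; apply: AB; lia.
rewrite -(@triangle_sum _ K (fun i j => A i (B j v)) AB).
by apply: eq_bigr => i _; rewrite (lin_sum _ _ _ (lA i)).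
Qed.

Definition expterm G (n : nat) : V -> V := fun v => n`!%:R^-1 *: iter n G v.
Definition oexp G : V -> V := lsum [set: nat] (expterm G).

Lemma lin_expterm G n : lin G -> lin (expterm G n).
Proof. by move=> lG; apply/lin_scale/lin_iter. Qed.

Lemma Fop_expterm G n : Fop (- 2) G -> Fop (0 - 2 * n%:Z) (expterm G n).
Proof.
move=> fG; apply: (Fop_scale fk); elim: n => [|n IH].
  by apply: Fop_eq (@Fop_id _ _ Fil).
by apply: Fop_eq (Fop_comp fG IH); lia.
Qed.

Lemma expterm_succ G n v : lin G -> G (expterm G n v) = n.+1%:R *: expterm G n.+1 v.
Proof.
move=> lG; rewrite /expterm (linZ _ _ lG) scalerA factS natrM invfM mulrA.
by rewrite divff ?F0 // mul1r.
Qed.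

Lemma lin_oexp G : lin G -> Fop (- 2) G -> lin (oexp G).
Proof.
move=> lG fG; apply: lin_lsum => [|n _]; last exact: lin_expterm.
by apply: (locfin_nat fk) => n; [exact: lin_expterm|exact: Fop_expterm].
Qed.

Lemma oexp_one G : lin G -> Fop (- 2) G -> oexp G one = one.
Proof.
move=> lG fG; have G1 : G one = 0.
  by apply: (Fil_lt0 fk _ (fG _ _ (Fil_one fk))).
have it n : iter n.+1 G one = 0.
  by elim: n => [//|n IH]; rewrite iterS IH (lin0 lG).
rewrite /oexp /lsum (@fsum_nat _ _ 1); last first.
  by case=> // n _; rewrite /expterm it scaler0.
by rewrite big_ord1 /expterm /= fact0 invr1 scale1r.
Qed.

(** This is ad_G^n(X) / n!, the factorial accumulating from the factors 1/n. *)
Fixpoint adterm G X (n : nat) : V -> V :=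
  if n is n'.+1 then fun v => n%:R^-1 *: comm G (adterm G X n') v else X.

Lemma cls_adterm d e G X n : cls 3 (- 2) G -> cls d e X ->
  cls d (e - 2 * n%:Z) (adterm G X n).
Proof.
move=> [lG fG eG] hX; elim: n => [|n [lA fA eA]]; first by apply: cls_eq hX; lia.
apply: (cls_scale fk); split; first exact: lin_comm.
  by apply: Fop_eq (Fop_comm fk fG fA); lia.
exact: (Ew_comm_quadratic fk).
Qed.

(** The degree-n part in G of e^G X = (e^(ad G) X) e^G. With A_i and E_i the terms of [adterm] and
    [expterm], the induction rests on G A_i E_(n-i) = (i + 1) A_(i+1) E_(n-i) + (n - i + 1) A_i
    E_(n-i+1). *)
Lemma expterm_adterm G X n v : lin G -> lin X ->
  expterm G n (X v) = \sum_(i < n.+1) adterm G X i (expterm G (n - i) v).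
Proof.
move=> lG lX; have lA i : lin (adterm G X i).
  by elim: i => [//|i IH]; apply: lin_scale; apply: lin_comm.
elim: n => [|n IH]; first by rewrite big_ord1 /expterm /= fact0 invr1 !scale1r.
apply: (scalerI (F0 n)); rewrite -expterm_succ // IH (lin_sum _ _ _ lG).
transitivity (\sum_(i < n.+1) ((n - i).+1%:R *: adterm G X i (expterm G (n - i).+1 v)
     + i.+1%:R *: adterm G X i.+1 (expterm G (n - i) v))).
  apply: eq_bigr => i _ /=; rewrite scalerA divff ?F0 // scale1r /comm.
  by rewrite expterm_succ // (linZ _ _ (lA i)) addrC subrK.
rewrite big_split /= scaler_sumr.
(* Each sum is padded by a term with coefficient 0, at i = n + 1 and at i = 0 respectively; the two
   coefficients of every term then add up to n + 1. *)
transitivity (\sum_(i < n.+2) (n.+1 - i)%:R *: adterm G X i (expterm G (n.+1 - i) v)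
  + \sum_(i < n.+2) i%:R *: adterm G X i (expterm G (n.+1 - i) v)).
  rewrite [X in _ = X + _]big_ord_recr [X in _ = _ + X]big_ord_recl /=.
  rewrite subnn !scale0r addr0 add0r; congr (_ + _); apply: eq_bigr => i _.
    by rewrite subSn // -ltnS.
  rewrite /bump /= ?add1n ?subSS.
rewrite -big_split /=; apply: eq_bigr => i _.
by rewrite -scalerDl -natrD subnK // -ltnS.
Qed.

(** Stated as an intertwining relation, so that it does not presuppose an inverse of the
    exponential. *)
Lemma oexp_conj d e G X : cls 3 (- 2) G -> cls d e X ->
  exists2 Y, cls d e Y & oexp G \o X = Y \o oexp G.
Proof.
move=> hG hX; exists (lsum [set: nat] (adterm G X)).
  by apply: (cls_lsum_nat fk) => n; apply: cls_adterm.
have [lG fG eG] := hG; have [lX fX eX] := hX.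
rewrite (@lsum_cauchy e 0); first last.
- by move=> n; apply: Fop_expterm.
- by move=> n; have [] := cls_adterm n hG hX.
- by move=> n; apply: lin_expterm.
- by move=> n; have [] := cls_adterm n hG hX.
apply/funext => v; rewrite /oexp /lsum /=; apply: eq_fsbigr => n _.
exact: expterm_adterm.
Qed.

Lemma oexp_inv G : lin G -> Fop (- 2) G ->
  oexp G \o oexp (fun v => -1 *: G v) = id.
Proof.
move=> lG fG; have lG' : lin (fun v => -1 *: G v) by exact: lin_scale.
have fG' : Fop (- 2) (fun v => -1 *: G v) by exact: (Fop_scale fk).
rewrite (@lsum_cauchy 0 0); first last.
- by move=> n; apply: Fop_expterm.
- by move=> n; apply: Fop_expterm.
- by move=> n; apply: lin_expterm.
- by move=> n; apply: lin_expterm.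
have itN j v : iter j (fun v => -1 *: G v) v = (-1) ^+ j *: iter j G v.
  elim: j => [|j IH] /=; first by rewrite scale1r.
  by rewrite IH (linZ _ _ lG) scalerA -exprS.
have term n v : \sum_(i < n.+1) expterm G i (expterm (fun v => -1 *: G v) (n - i) v)
    = n`!%:R^-1 * (0 : F) ^+ n *: iter n G v.
  (* Reading [0 ^+ n] as the n-th power of -1 + 1 makes the convolution a binomial expansion. *)
  have -> : 0 = -1 + 1 :> F by rewrite addNr.
  rewrite exprDn mulr_sumr scaler_suml; apply: eq_bigr => i _.
  have le : (i <= n)%N by rewrite -ltnS.
  rewrite /expterm itN !(linZ _ _ (lin_iter i lG)) -iterD subnKC //.
  rewrite !scalerA expr1n mulr1; congr (_ *: _).
  have fn0 k : k`!%:R != 0 :> F.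
    by have := F0 (k`!).-1; rewrite prednK ?fact_gt0.
  rewrite -[_ *+ 'C(_, _)]mulr_natr -(bin_fact le) !natrM !invfM.
  have c0 : 'C(n, i)%:R != 0 :> F.
    by have := F0 ('C(n, i)).-1; rewrite prednK ?bin_gt0.
  move: (fn0 i) (fn0 (n - i)%N) c0; move: (i`!%:R : F) => x; move: ((n - i)`!%:R : F) => y.
  move: ('C(n, i)%:R : F) ((-1) ^+ (n - i) : F) => z t x0 y0 z0.
  by field; rewrite x0 y0 z0.
apply/funext => v; rewrite /lsum (@fsum_nat _ _ 1).
  by rewrite big_ord1 term /= fact0 invr1 mulr1 scale1r.
by case=> // n _; rewrite term expr0n mulr0 scale0r.
Qed.

End Exponentials.

(** * Normal forms of quadratic and cubic operators *)

Section QuadraticOperators.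

Variables (F : fieldType) (V : lmodType F) (N : nat).
Variables (one : V) (gen : 'I_N * int -> V -> V) (Fil : int -> V -> Prop).
Hypothesis fk : fock one gen Fil.
Hypothesis F0 : forall n : nat, n.+1%:R != 0 :> F.
Local Notation cls := (cls gen Fil).
Implicit Types (x y : 'I_N * nat) (Q : V -> V).

(** For x = (a, k) this models the derivative by T^a_k, and [cre x] the multiplication by T^a_k; the
    shift to k + 1 comes from the indexing of the generators. *)
Definition ann x : V -> V := gen (x.1, x.2.+1%:Z).
Definition cre x : V -> V := gen (x.1, - x.2%:Z).

Lemma cls_ann x : cls 2 (- 1 - 2 * x.2%:Z) (ann x).
Proof. by apply: cls_eq (cls_gen fk (x.1, x.2.+1%:Z)) => /=; lia. Qed.

Lemma lin_ann x : lin (ann x). Proof. exact: (fock_lin fk). Qed.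
Lemma lin_cre x : lin (cre x). Proof. exact: (fock_lin fk). Qed.

Lemma comm_ann_cre x y : comm (ann x) (cre y) = (fun v => (x == y)%:R *: v).
Proof.
rewrite (fock_comm fk) /omega /=; apply/funext => v; congr (_ *: _).
case: x y => [a n] [b m] /=; rewrite xpair_eqE.
have -> : (n.+1%:Z + - m%:Z == 1) = (n == m) by lia.
by case: ifP.
Qed.

Lemma ann_one x : ann x one = 0. Proof. exact: (gen_one fk). Qed.

Lemma locfin_ann (A : 'I_N * nat -> V -> V) : (forall x, lin (A x)) ->
  locfin [set: 'I_N * nat] (fun x v => A x (ann x v)).
Proof.
move=> lA; have h : locfin [set: 'I_N * nat] ann.
  apply: (@locfin_weight _ _ _ _ _ _ fk _ _ (fun x => - 1 - 2 * x.2%:Z)).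
  - exact: lin_ann.
  - by move=> x; have [] := cls_ann x.
  - move=> b; apply: (@sub_finite_set _ _ ([set: 'I_N] `*` `I_b.+1)).
      by move=> [a n] [_ /= le]; split => //=; lia.
    by apply: finite_setX; [exact: finite_finset|exact: finite_II].
move=> v; apply: sub_finite_set (h v) => x [_ ne]; split => // e.
by apply: ne; rewrite e (lin0 (lA x)).
Qed.

(* Half of the coefficient of d_x d_y goes to U_x and half to U_y. *)
Lemma quadratic_form Q : cls 3 0 Q -> Q one = 0 ->
  exists2 U : 'I_N * nat -> V -> V, (forall x, cls 2 (1 + 2 * x.2%:Z) (U x)) &
    Q = lsum [set: 'I_N * nat] (fun x v => U x (ann x v)).
Proof.
move=> hQ Q1; have [lQ fQ eQ] := hQ.
have hC x : cls 2 (1 + 2 * x.2%:Z) (comm Q (cre x)).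
  by apply: cls_eq (cls_comm_gen fk (x.1, - x.2%:Z) hQ) => /=; lia.
have /boolp.choice [s hs] : forall xy : ('I_N * nat) * ('I_N * nat), exists c : F,
    comm (comm Q (cre xy.1)) (cre xy.2) = (fun v => c *: v).
  move=> [x y] /=; apply: (Ew_scalar fk).
    by apply: lin_comm (lin_cre y); have [] := hC x.
  by have [_ _] := hC x; apply.
have sC x y : s (x, y) = s (y, x).
  have := comm_gen_swap fk (x.1, - x.2%:Z) (y.1, - y.2%:Z) lQ.
  rewrite -!/(cre _) (hs (x, y)) (hs (y, x)) => /(congr1 (fun A : V -> V => A one)) /eqP.
  rewrite -subr_eq0 -scalerBl scaler_eq0 subr_eq0 => /orP[/eqP //|/eqP].
  by move/(fock_one fk).
pose S x := lsum [set: 'I_N * nat] (fun y v => s (x, y) *: ann y v).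
have lsc x y : lin (fun v : V => s (x, y) *: v) by apply: lin_scale; apply: lin_id.
have lfS x : locfin [set: 'I_N * nat] (fun y v => s (x, y) *: ann y v).
  exact: (@locfin_ann (fun y v => s (x, y) *: v)).
have hS x : cls 2 (1 + 2 * x.2%:Z) (S x).
  suff h (y : 'I_N * nat) : cls 2 (1 + 2 * x.2%:Z) (ann y).
    by apply: (cls_lsum fk) => // y _; apply: (cls_scale fk).
  by apply: (cls_weaken fk) (cls_ann y); exists (1 + x.2 + y.2)%N; lia.
(* For Q = sum u_x d_x + 1/2 sum s(x,y) d_x d_y with u_x free of derivatives, the commutator is u_x
   + S_x. Half of S_x is removed because the sum over x meets each mixed d_x d_y twice. *)
pose U x := fun v => comm Q (cre x) v - 2^-1 *: S x v.
have hU x : cls 2 (1 + 2 * x.2%:Z) (U x).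
  by apply: (cls_sub fk) => //; apply: (cls_scale fk).
exists U => //.
have lU x : lin (U x) by have [] := hU x.
have lfU := locfin_ann lU.
have lsU : lin (lsum [set: 'I_N * nat] (fun x v => U x (ann x v))).
  by apply: lin_lsum => // x _; apply: lin_comp => //; apply: lin_ann.
have two : 2 != 0 :> F by exact: (F0 1).
have commS z x : comm (S x) (cre z) = (fun v => s (x, z) *: v).
  rewrite comm_lsum //; last exact: lin_cre.
  apply/funext => v; rewrite /lsum (@fsum_single _ _ _ _ z) => [|y ne].
    by rewrite comm_scalel ?comm_ann_cre ?eqxx ?scale1r //; apply: lin_cre.
  rewrite comm_scalel ?comm_ann_cre; last exact: lin_cre.
  by rewrite (negbTE ne) scale0r scaler0.
have commU z x : comm (U x) (cre z) = (fun v => (2^-1 * s (x, z)) *: v).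
  have -> : U x = (fun v => comm Q (cre x) v + (- 2^-1) *: S x v).
    by apply/funext => v; rewrite scaleNr.
  rewrite comm_addl ?comm_scalel; [|exact: lin_cre..].
  rewrite (hs (x, z)) commS; apply/funext => v; rewrite scalerA -scalerDl.
  by congr (_ *: _) => /=; field.
(* Both operators kill [one], so commutators with [cre z] decide. The sum yields [U z] from the
   bracket of [ann z] and half of [S z] from the brackets of the [U x], together
   [comm Q (cre z)]. *)
have : (fun v => Q v - lsum [set: 'I_N * nat] (fun x v => U x (ann x v)) v) = (fun=> 0).
  apply: (fock_cyclic fk); first exact: lin_sub.
    move=> a n; rewrite -[gen _]/(cre (a, n)); set z := (a, n).
    have -> : (fun v => Q v - lsum [set: 'I_N * nat] (fun x v => U x (ann x v)) v) =
              (fun v => Q v + -1 *: lsum [set: 'I_N * nat] (fun x v => U x (ann x v)) v).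
      by apply/funext => v; rewrite scaleN1r.
    rewrite comm_addl ?comm_scalel; [|exact: lin_cre..].
    rewrite comm_lsum //; last exact: lin_cre.
    apply/funext => v.
    have -> : lsum [set: 'I_N * nat] (fun x => comm (fun v => U x (ann x v)) (cre z)) v
       = lsum [set: 'I_N * nat] (fun x v => (x == z)%:R *: U x v
            + 2^-1 *: (s (z, x) *: ann x v)) v.
      apply: eq_fsbigr => x _.
      have := comm_mull (A := U x) (ann x) (cre z) (lU x).
      move=> /(congr1 (fun A : V -> V => A v)) /= ->.
      by rewrite comm_ann_cre commU (linZ _ _ (lU x)) scalerA (sC x z).
    rewrite lsum_add; first last.
    - by apply: (@locfin_ann (fun x v => 2^-1 *: (s (z, x) *: v))) => x; apply: lin_scale.
    - move=> u; apply: (@sub_finite_set _ _ [set z]); last exact: finite_set1.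
      by move=> x [_]; case: eqVneq => // _; rewrite scale0r.
    rewrite {1}/lsum (@fsum_single _ _ _ _ z) => [|x ne]; last first.
      by rewrite (negbTE ne) scale0r.
    rewrite eqxx scale1r.
    have -> : lsum [set: 'I_N * nat] (fun x v => 2^-1 *: (s (z, x) *: ann x v)) v
              = 2^-1 *: S z v.
      have [t [ut tD h]] := locfin_seq [:: v] (lfS z).
      have h' x : x \notin t -> s (z, x) *: ann x v = 0.
        by move=> xt; apply: h; rewrite ?inE.
      rewrite /S /lsum !(fsum_seq ut tD) ?scaler_sumr // => x _ xt.
        by rewrite h'.
      by rewrite h' // scaler0.
    by rewrite /U subrK scaleN1r subrr.
  rewrite Q1 sub0r; apply/eqP; rewrite oppr_eq0; apply/eqP.
  by rewrite /lsum fsbig1 // => x _; rewrite ann_one (lin0 (lU x)).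
move=> h; apply/funext => v; apply/eqP; rewrite -subr_eq0; apply/eqP.
exact: (congr1 (fun B : V -> V => B v) h).
Qed.

End QuadraticOperators.

(** * Triple commutators of cubic operators *)

Section CubicOperators.

Variables (F : fieldType) (V : lmodType F) (N : nat).
Variables (one : V) (gen : 'I_N * int -> V -> V) (Fil : int -> V -> Prop).
Hypothesis fk : fock one gen Fil.
Hypothesis F0 : forall n : nat, n.+1%:R != 0 :> F.
Local Notation cls := (cls gen Fil).
Local Notation omega := (@omega F N).
Implicit Types (x y z t u s : 'I_N * int) (X : V -> V) (v : V).

Let lg x : lin (gen x). Proof. exact: (fock_lin fk). Qed.

Definition comm3 X x y z := comm (comm (comm X (gen x)) (gen y)) (gen z).

Lemma comm3_add X Y x y z : comm3 (fun v => X v + Y v) x y z =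
  (fun v => comm3 X x y z v + comm3 Y x y z v).
Proof. by rewrite /comm3 !comm_addl. Qed.

Lemma comm3_scale k X x y z : comm3 (fun v => k *: X v) x y z =
  (fun v => k *: comm3 X x y z v).
Proof. by rewrite /comm3 !comm_scalel. Qed.

Lemma comm_sum (I : Type) (r : seq I) (f : I -> V -> V) B : lin B ->
  comm (fun v => \sum_(i <- r) f i v) B = (fun v => \sum_(i <- r) comm (f i) B v).
Proof. by move=> lB; apply/funext => v; rewrite /comm (lin_sum _ _ _ lB) sumrB. Qed.

Lemma comm3_sum (I : Type) (r : seq I) (f : I -> V -> V) x y z :
  comm3 (fun v => \sum_(i <- r) f i v) x y z =
  (fun v => \sum_(i <- r) comm3 (f i) x y z v).
Proof. by rewrite /comm3 !comm_sum. Qed.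

Lemma comm3_lsum (I : choiceType) (D : set I) (f : I -> V -> V) x y z : locfin D f ->
  comm3 (lsum D f) x y z = lsum D (fun i => comm3 (f i) x y z).
Proof.
move=> lf; have lf1 := locfin_comm (lg x) lf; have lf2 := locfin_comm (lg y) lf1.
by rewrite /comm3 (comm_lsum _ lf) // (comm_lsum _ lf1) // (comm_lsum _ lf2).
Qed.

Lemma comm3_swapl X x y z : lin X -> comm3 X x y z = comm3 X y x z.
Proof. by move=> lX; rewrite /comm3 (comm_gen_swap fk x y lX). Qed.

Lemma comm3_swapr X x y z : lin X -> comm3 X x y z = comm3 X x z y.
Proof. by move=> lX; rewrite /comm3 (comm_gen_swap fk y z (lin_comm lX (lg x))). Qed.

Lemma comm2_gen x y t u :
  comm (comm (gen x \o gen y) (gen t)) (gen u) =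
  (fun v => (omega y t * omega x u + omega x t * omega y u) *: v).
Proof.
rewrite comm_mull // !(fock_comm fk) comm_addl // comm_scalel // (fock_comm fk).
have -> : (fun v => gen x (omega y t *: v)) = (fun v => omega y t *: gen x v).
  by apply/funext => v; rewrite (linZ _ _ (lg x)).
rewrite comm_scalel // (fock_comm fk); apply/funext => v.
by rewrite !scalerA -scalerDl.
Qed.

(** Wick's rule: the scalar is the sum over the six ways of pairing the three factors with [t], [u],
    [s]. *)
Lemma comm3_gen x y z t u s :
  comm3 (gen x \o gen y \o gen z) t u s =
  (fun v => (omega z t * (omega y u * omega x s + omega x u * omega y s)
           + omega y t * (omega z u * omega x s + omega x u * omega z s)
           + omega x t * (omega z u * omega y s + omega y u * omega z s)) *: v).
Proof.
have lxy : lin (gen x \o gen y) by apply: lin_comp.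
have e1 : comm (gen x \o gen y \o gen z) (gen t) = (fun v =>
    omega z t *: (gen x \o gen y) v + (omega y t *: (gen x \o gen z) v
     + omega x t *: (gen y \o gen z) v)).
  rewrite comm_mull // (fock_comm fk).
  apply/funext => v; rewrite comm_mull // !(fock_comm fk) /=.
  by rewrite !(linZ _ _ (lg _)).
rewrite /comm3 e1.
have e2 k l m P Q R B : lin B -> comm (fun v => k *: P v + (l *: Q v + m *: R v)) B =
    (fun v => k *: comm P B v + (l *: comm Q B v + m *: comm R B v)).
  move=> lB; rewrite (comm_addl (fun v => k *: P v)) //.
  rewrite (comm_addl (fun v => l *: Q v)) //.
  by rewrite (comm_scalel _ P) // (comm_scalel _ Q) // (comm_scalel _ R).
rewrite (e2 _ _ _ (gen x \o gen y) (gen x \o gen z) (gen y \o gen z)) // e2 //.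
rewrite !comm2_gen.
by apply/funext => v; rewrite !scalerA -!scalerDl !addrA.
Qed.

(** The sign in the pairing of index i with its only dual index 1 - i. *)
Definition sgen (i : int) : F := if 0 < i then 1 else -1.

Lemma sgen_sqr i : sgen i * sgen i = 1.
Proof. by rewrite /sgen; case: ifP => _; rewrite ?mul1r // mulrNN mul1r. Qed.

Lemma omegaE a i y : omega (a, i) y =
  if (a == y.1) && (i == 1 - y.2) then sgen i else 0.
Proof. by rewrite /omega /=; have -> : (i + y.2 == 1) = (i == 1 - y.2) by lia. Qed.

Definition sorted3 (i j k : int) : bool := (i <= j) && (j <= k).

Definition cubicD : set (int * int * int) :=
  [set ijk | let: (i, j, k) := ijk in [/\ i <= j, j <= k & 0 <= i + j + k]].

Definition cubic_term (A : 'I_N -> 'I_N -> 'I_N -> int -> int -> int -> F)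
  a b c (ijk : int * int * int) : V -> V := let: (i, j, k) := ijk in
  fun v => A a b c i j k *: (gen (a, i) \o gen (b, j) \o gen (c, k)) v.

Definition cubic_sum A : V -> V := fun v =>
  \sum_(a < N) \sum_(b < N) \sum_(c < N) lsum cubicD (cubic_term A a b c) v.

Definition linear_sum (B : 'I_N -> int -> F) : V -> V := fun v =>
  \sum_(a < N) lsum [set j : int | -1 <= j] (fun j v => B a j *: gen (a, j) v) v.

Lemma finite_int_interval (n : nat) : finite_set [set i : int | - n%:Z <= i <= n%:Z].
Proof.
apply: (@sub_finite_set _ _ ((fun k : nat => k%:Z - n%:Z) @` `I_(2 * n).+1)).
  move=> i /andP[h1 h2]; exists (absz (i + n%:Z)); rewrite /=; lia.
exact/finite_image/finite_II.
Qed.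

Lemma gen_vanish v : exists b : nat, forall a (k : int), b%:Z < k -> gen (a, k) v = 0.
Proof.
have [b hb] := Fop_vanish fk v; exists b => a k lt.
by apply: (hb _ _ (lg _) (Fop_gen fk (a, k))) => /=; lia.
Qed.

(** The rightmost factor bounds k by some n depending on [v]; then i <= j <= k and i + j + k >= 0
    leave i >= -2n, whence the interval of radius 2n. *)
Lemma locfin_cubic A a b c : locfin cubicD (cubic_term A a b c).
Proof.
move=> v; have [n hn] := gen_vanish v.
have fin := finite_int_interval (2 * n); apply: sub_finite_set
  (finite_setX (finite_setX fin fin) fin) => -[[i j] k] /= [[ij jk s0] ne].
have kn : k <= n%:Z.
  rewrite leNgt; apply/negP => /hn h; apply: ne.
  by rewrite /= h !(lin0 (lg _)) scaler0.
by split; [split|]; apply/andP; split; lia.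
Qed.

Lemma cls_cubic_sum A : cls 4 3 (cubic_sum A).
Proof.
apply: (cls_sum fk) => a; apply: (cls_sum fk) => b; apply: (cls_sum fk) => c.
apply: (cls_lsum fk); first exact: locfin_cubic.
move=> [[i j] k] [ij jk s0]; apply: (cls_scale fk).
have h := cls_comp fk (cls_comp fk (cls_gen fk (a, i)) (cls_gen fk (b, j)))
  (cls_gen fk (c, k)).
by apply: (cls_weaken fk) h; exists (absz (i + j + k)) => /=; lia.
Qed.

Lemma locfin_linear B a : locfin [set j : int | -1 <= j] (fun j v => B a j *: gen (a, j) v).
Proof.
move=> v; have [n hn] := gen_vanish v.
apply: sub_finite_set (finite_int_interval n.+1) => j /= [j1 ne].
have kn : j <= n%:Z.
  by rewrite leNgt; apply/negP => /hn h; apply: ne; rewrite h scaler0.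
by apply/andP; split; lia.
Qed.

Lemma cls_linear_sum B : cls 2 3 (linear_sum B).
Proof.
apply: (cls_sum fk) => a; apply: (cls_lsum fk); first exact: locfin_linear.
move=> j j1; apply: (cls_scale fk); apply: (cls_weaken fk) (cls_gen fk (a, j)).
by exists (absz (j + 1)) => /=; move: j1 => /=; lia.
Qed.

Lemma seq_single (I : eqType) (s : seq I) (g : I -> V) i0 : uniq s ->
  (forall i, i != i0 -> g i = 0) ->
  \sum_(i <- s) g i = if i0 \in s then g i0 else 0.
Proof.
move=> us g0; case: ifP => is_; first by rewrite (bigD1_seq i0) //= big1 ?addr0.
rewrite big1_seq // => i /andP[_ i_s]; apply: g0.
by apply: contraFneq is_ => <-.
Qed.

Lemma sum_omega3 A (s : seq (int * int * int)) x y z v : uniq s ->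
  \sum_(a < N) \sum_(b < N) \sum_(c < N) \sum_(ijk <- s)
    (let: (i, j, k) := ijk in
     (A a b c i j k * (omega (a, i) x * omega (b, j) y * omega (c, k) z)) *: v)
  = if (1 - x.2, 1 - y.2, 1 - z.2) \in s then
      (A x.1 y.1 z.1 (1 - x.2) (1 - y.2) (1 - z.2) *
       (sgen (1 - x.2) * sgen (1 - y.2) * sgen (1 - z.2))) *: v else 0.
Proof.
move=> us.
rewrite (bigD1 x.1) //= [X in _ + X]big1 => [|a ne]; last first.
  rewrite big1 // => b _; rewrite big1 // => c _; rewrite big1 // => -[[i j] k] _.
  by rewrite omegaE (negbTE ne) !mul0r mulr0 scale0r.
rewrite addr0 (bigD1 y.1) //= [X in _ + X]big1 => [|b ne]; last first.
  rewrite big1 // => c _; rewrite big1 // => -[[i j] k] _.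
  by rewrite (omegaE b) (negbTE ne) mulr0 mul0r mulr0 scale0r.
rewrite addr0 (bigD1 z.1) //= [X in _ + X]big1 => [|c ne]; last first.
  by rewrite big1 // => -[[i j] k] _; rewrite (omegaE c) (negbTE ne) !mulr0 scale0r.
rewrite addr0 (@seq_single _ _ _ (1 - x.2, 1 - y.2, 1 - z.2)) //.
  by rewrite !omegaE !eqxx.
move=> [[i j] k]; rewrite !xpair_eqE !omegaE !eqxx /=.
case: eqP => _; last by rewrite !mul0r mulr0 scale0r.
case: eqP => _; last by rewrite mulr0 mul0r mulr0 scale0r.
by case: eqP => //= _ _; rewrite !mulr0 scale0r.
Qed.

Definition cubicb (i j k : int) : bool := [&& i <= j, j <= k & 0 <= i + j + k].

(** By Wick's rule a product survives only if its indices rearrange the duals i, j, k, and the six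
    rearrangements match the six pairings. For repeated indices several conditions hold together and
    each one counts. *)
Lemma comm3_cubic_sum A x y z v :
  let i := 1 - x.2 in let j := 1 - y.2 in let k := 1 - z.2 in
  let kappa := sgen i * sgen j * sgen k in
  let a := x.1 in let b := y.1 in let c := z.1 in
  comm3 (cubic_sum A) x y z v = (kappa *
    ((if cubicb i j k then A a b c i j k else 0)
   + (if cubicb i k j then A a c b i k j else 0)
   + (if cubicb j i k then A b a c j i k else 0)
   + (if cubicb j k i then A b c a j k i else 0)
   + (if cubicb k i j then A c a b k i j else 0)
   + (if cubicb k j i then A c b a k j i else 0))) *: v.
Proof.
move=> i j k kappa a b c.
(* Rearrangements may coincide; as a summation range they must be listed without repetition. *)
pose s := [seq p <- undup [:: (i, j, k); (i, k, j); (j, i, k); (j, k, i); (k, i, j); (k, j, i)]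
  | cubicb p.1.1 p.1.2 p.2].
have us : uniq s by rewrite filter_uniq // undup_uniq.
have sE p : p \in [:: (i, j, k); (i, k, j); (j, i, k); (j, k, i); (k, i, j); (k, j, i)] ->
    (p \in s) = cubicb p.1.1 p.1.2 p.2.
  by move=> h; rewrite mem_filter mem_undup h andbT.
rewrite /cubic_sum !comm3_sum /=.
transitivity (\sum_(a < N) \sum_(b < N) \sum_(c < N) \sum_(ijk <- s)
   comm3 (cubic_term A a b c ijk) x y z v).
  apply: eq_bigr => a' _; rewrite comm3_sum; apply: eq_bigr => b' _.
  rewrite comm3_sum; apply: eq_bigr => c' _.
  rewrite comm3_lsum; last exact: locfin_cubic.
  rewrite /lsum (@fsum_seq _ _ _ _ s) //.
    by move=> [[p q] r]; rewrite mem_filter => /andP[/and3P[]].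
  move=> [[p q] r] Dp; rewrite mem_filter mem_undup.
  have -> : cubicb p q r by apply/and3P.
  rewrite andTb /cubic_term comm3_scale comm3_gen !omegaE -/i -/j -/k.
  move=> nin; rewrite [X in X *: v](_ : _ = 0) ?scale0r ?scaler0 //.
  have nn (i' j' k' : int) : (i', j', k') \in
      [:: (i, j, k); (i, k, j); (j, i, k); (j, k, i); (k, i, j); (k, j, i)] ->
     [&& p == i', q == j' & r == k'] = false.
    by move=> h; apply: contraNF nin => /and3P[/eqP -> /eqP -> /eqP ->].
  have h1 := nn i j k; have h2 := nn i k j; have h3 := nn j i k.
  have h4 := nn j k i; have h5 := nn k i j; have h6 := nn k j i.
  rewrite !inE !eqxx ?orbT in h1 h2 h3 h4 h5 h6.
  move: {h1 h2 h3 h4 h5 h6}(h1 isT) (h2 isT) (h3 isT) (h4 isT) (h5 isT) (h6 isT).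
  move: (p == i) (p == j) (p == k) (q == i) (q == j) (q == k) (r == i) (r == j) (r == k).
  move: (a' == x.1) (a' == y.1) (a' == z.1) (b' == x.1) (b' == y.1) (b' == z.1)
        (c' == x.1) (c' == y.1) (c' == z.1).
  (* Outside [s] some index test fails in each of the six pairings. With the tests turned into 0 or
     1 in F, [ring] regroups the scalar so that every summand contains a vanishing product. *)
  have if_and (e1 e2 : bool) (g : F) :
      (if e1 && e2 then g else 0) = e1%:R * (e2%:R * g).
    by case: e1 e2 => [] []; rewrite /= ?mul1r ?mul0r.
  have toF (e1 e2 e3 : bool) : [&& e1, e2 & e3] = false ->
      e1%:R * e2%:R * e3%:R = 0 :> F.
    by case: e1 e2 e3 => [] [] []; rewrite //= ?mulr0 ?mul0r.
  move=> x1 x2 x3 y1 y2 y3 z1 z2 z3 pi pj pk qi qj qk ri rj rk.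
  move=> /toF h1 /toF h2 /toF h3 /toF h4 /toF h5 /toF h6.
  rewrite !if_and; move: h1 h2 h3 h4 h5 h6.
  move: (x1%:R : F) (x2%:R : F) (x3%:R : F) (y1%:R : F) (y2%:R : F) (y3%:R : F)
   (z1%:R : F) (z2%:R : F) (z3%:R : F) (pi%:R : F) (pj%:R : F) (pk%:R : F)
   (qi%:R : F) (qj%:R : F) (qk%:R : F) (ri%:R : F) (rj%:R : F) (rk%:R : F).
  clear; move=> x1 x2 x3 y1 y2 y3 z1 z2 z3 pi pj pk qi qj qk ri rj rk h1 h2 h3 h4 h5 h6.
  transitivity (sgen p * sgen q * sgen r * (z1 * y2 * x3 * (pk * qj * ri) +
    z1 * x2 * y3 * (pj * qk * ri) + y1 * z2 * x3 * (pk * qi * rj) +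
    y1 * x2 * z3 * (pj * qi * rk) + x1 * z2 * y3 * (pi * qk * rj) +
    x1 * y2 * z3 * (pi * qj * rk))); first by ring.
  by rewrite h1 h2 h3 h4 h5 h6 !mulr0 !addr0 mulr0.
pose T x y z := \sum_(a < N) \sum_(b < N) \sum_(c < N) \sum_(ijk <- s)
    (let: (i, j, k) := ijk in
     (A a b c i j k * (omega (a, i) x * omega (b, j) y * omega (c, k) z)) *: v).
transitivity (T x y z + T x z y + T y x z + T y z x + T z x y + T z y x).
  rewrite /T -!big_split; apply: eq_bigr => a' _.
  rewrite -!big_split; apply: eq_bigr => b' _.
  rewrite -!big_split; apply: eq_bigr => c' _.
  rewrite -!big_split; apply: eq_bigr => -[[p q] r] _ /=.
  rewrite comm3_scale comm3_gen scalerA -!scalerDl; congr (_ *: _).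
  by ring.
rewrite /T !sum_omega3 // -/i -/j -/k -/a -/b -/c !sE ?inE ?eqxx ?orbT //=.
have ifZ (e : bool) (c1 c2 : F) : c1 = kappa ->
    (if e then (c2 * c1) *: v else 0) = (kappa * (if e then c2 else 0)) *: v.
  by move=> ->; case: e; rewrite ?mulr0 ?scale0r // mulrC.
by rewrite !ifZ -?scalerDl -?mulrDr // /kappa; ring.
Qed.

End CubicOperators.

(** * Recovering the coefficients from commutators *)

Section CubicForm.

Variables (F : fieldType) (V : lmodType F) (N : nat).
Variables (one : V) (gen : 'I_N * int -> V -> V) (Fil : int -> V -> Prop).
Hypothesis fk : fock one gen Fil.
Hypothesis F0 : forall n : nat, n.+1%:R != 0 :> F.
Local Notation cls := (cls gen Fil).
Implicit Types (x y z : 'I_N * int) (X : V -> V) (v : V).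

Let lg x : lin (gen x). Proof. exact: (fock_lin fk). Qed.

Lemma scalar_inj (c d : F) : (fun v : V => c *: v) = (fun v => d *: v) -> c = d.
Proof.
move=> /(congr1 (fun A : V -> V => A one)) /eqP.
rewrite -subr_eq0 -scalerBl scaler_eq0 subr_eq0 => /orP[/eqP //|/eqP].
by move/(fock_one fk).
Qed.

Lemma cls1_odd e X : cls 1 e X -> (forall k : nat, e <> 2 * k%:Z) -> X = (fun=> 0).
Proof.
move=> [lX fX eX] odd; have [c Xc] := Ew_scalar fk lX eX.
have [c0|/eqP c0] := eqVneq c 0; first by rewrite Xc c0; apply/funext => v; rewrite scale0r.
by rewrite Xc in fX; have [k /odd] := scalar_weight fk fX c0.
Qed.

(* The number of sorted rearrangements, 1, 2 or 6: when indices coincide, the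
   same product of generators occurs that many times in cubic_sum. *)
Definition nsorted (i j k : int) : nat :=
  (sorted3 i j k + sorted3 i k j + sorted3 j i k + sorted3 j k i
   + sorted3 k i j + sorted3 k j i)%N.

Lemma nsorted_gt0 i j k : (0 < nsorted i j k)%N.
Proof. by rewrite /nsorted /sorted3; lia. Qed.

Lemma nsortedCA i j k : nsorted i j k = nsorted j i k.
Proof. by rewrite /nsorted; lia. Qed.

Lemma nsortedAC i j k : nsorted i j k = nsorted i k j.
Proof. by rewrite /nsorted; lia. Qed.

(** The triple commutators of [X] are scalars, symmetric in the generators. Matching them by sorted
    products leaves a remainder without triple commutators, hence at most quadratic. *)
Lemma cubic_part X : cls 4 3 X -> exists A, cls 3 3 (fun v => X v - cubic_sum gen A v).
Proof.
move=> hX; have [lX fX eX] := hX.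
have cX x y z := cls_comm_gen fk z (cls_comm_gen fk y (cls_comm_gen fk x hX)).
have /boolp.choice [c hc] : forall p : ('I_N * int) * ('I_N * int) * ('I_N * int),
    exists c : F, comm3 gen X p.1.1 p.1.2 p.2 = (fun v => c *: v).
  by move=> [[x y] z]; have [l _ e] := cX x y z; apply: (Ew_scalar fk).
have cl x y z : c (x, y, z) = c (y, x, z).
  by apply: scalar_inj; rewrite -(hc (x, y, z)) -(hc (y, x, z)) /= (comm3_swapl fk).
have cr x y z : c (x, y, z) = c (x, z, y).
  by apply: scalar_inj; rewrite -(hc (x, y, z)) -(hc (x, z, y)) /= (comm3_swapr fk).
have c0 x y z : c (x, y, z) <> 0 -> 0 <= (1 - x.2) + (1 - y.2) + (1 - z.2).
  move=> ne; have [_ f _] := cX x y z; rewrite -/(comm3 gen X x y z) (hc (x, y, z)) in f.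
  by have [k] := scalar_weight fk f ne; lia.
(* The scalar is read at the dual generators, of indices 1 - i, 1 - j, 1 - k. Division removes the
   pairing sign and the number of sorted rearrangements, which contribute equally by symmetry. *)
pose A (a b d : 'I_N) (i j k : int) := c ((a, 1 - i), (b, 1 - j), (d, 1 - k)) /
  ((sgen F i * sgen F j * sgen F k) * (nsorted i j k)%:R).
exists A; have hA := cls_cubic_sum fk A.
have h4 := cls_sub fk hX hA; have [l4 f4 _] := h4; split => // x y z.
have -> : (fun v => X v - cubic_sum gen A v) = (fun v => X v + -1 *: cubic_sum gen A v).
  by apply/funext => v; rewrite scaleN1r.
rewrite -[comm _ _]/(comm3 gen _ x y z) (comm3_add fk) (comm3_scale fk) (hc (x, y, z)).
apply/funext => v; rewrite (comm3_cubic_sum fk) /A !subKr -!surjective_pairing.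
rewrite (cr x z y) (cl y x z) (cr y z x) (cl y x z) (cl z x y) (cr x z y).
rewrite (cr z y x) (cl z x y) (cr x z y).
set C := c (x, y, z); set i := 1 - x.2; set j := 1 - y.2; set k := 1 - z.2.
rewrite (nsortedAC i k j) (nsortedCA j i k) (nsortedAC j k i) (nsortedCA j i k).
rewrite (nsortedCA k i j) (nsortedAC i k j) (nsortedAC k j i) (nsortedCA k i j).
rewrite (nsortedAC i k j).
set kappa := sgen F i * sgen F j * sgen F k.
have -> : sgen F i * sgen F k * sgen F j = kappa by rewrite /kappa; ring.
have -> : sgen F j * sgen F i * sgen F k = kappa by rewrite /kappa; ring.
have -> : sgen F j * sgen F k * sgen F i = kappa by rewrite /kappa; ring.
have -> : sgen F k * sgen F i * sgen F j = kappa by rewrite /kappa; ring.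
have -> : sgen F k * sgen F j * sgen F i = kappa by rewrite /kappa; ring.
have k0 : kappa != 0.
  apply/eqP => k0; have : kappa * kappa = 1.
    rewrite /kappa (_ : _ * _ = (sgen F i * sgen F i) * (sgen F j * sgen F j)
      * (sgen F k * sgen F k)); last by ring.
    by rewrite !sgen_sqr !mulr1.
  by rewrite k0 mul0r => /eqP; rewrite eq_sym oner_eq0.
have n0 : (nsorted i j k)%:R != 0 :> F.
  by have := F0 (nsorted i j k).-1; rewrite prednK ?nsorted_gt0.
(* For i + j + k < 0 [cubic_sum] has no term to match, but the weight bound already forces C = 0. *)
have [s0|s0] := boolP (0 <= i + j + k); last first.
  have C0 : C = 0 by apply: contrapT => /c0 le; rewrite le in s0.
  by rewrite C0 !mul0r !if_same !addr0 mulr0 !scale0r scaler0 addr0.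
have cb i' j' k' : i' + j' + k' = i + j + k -> cubicb i' j' k' = sorted3 i' j' k'.
  by rewrite /cubicb /sorted3 => ->; rewrite s0 andbT.
rewrite !cb; [|lia..].
set Q := C / _.
have ifE (b : bool) : (if b then Q else 0) = b%:R * Q by case: b; rewrite ?mul1r ?mul0r.
rewrite !ifE -!mulrDl -!natrD -/(nsorted i j k) /Q scaleN1r.
rewrite (_ : kappa * _ = C) ?subrr //.
by field; rewrite k0 n0.
Qed.

(** Double commutators are scalars with the odd weight bound 3 + (1 - 2i) + (1 - 2j), hence zero. *)
Lemma odd_quadratic_linear X : cls 3 3 X -> cls 2 3 X.
Proof.
move=> hX; have [lX fX _] := hX; split => // x y.
apply: (cls1_odd (cls_comm_gen fk y (cls_comm_gen fk x hX))) => k; lia.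
Qed.

(** Removing the linear form prescribed by the commutators leaves a scalar with odd weight bound,
    hence zero, so no constant term survives. The range j >= -1 expresses 1 - 2j <= 3. *)
Lemma linear_part X : cls 2 3 X -> exists B, X = linear_sum gen B.
Proof.
move=> hX; have [lX fX eX] := hX; have cX x := cls_comm_gen fk x hX.
have /boolp.choice [c hc] : forall x, exists c : F, comm X (gen x) = (fun v => c *: v).
  by move=> x; have [l _ e] := cX x; apply: (Ew_scalar fk).
have c0 x : c x <> 0 -> -1 <= 1 - x.2.
  move=> ne; have [_ f _] := cX x; rewrite (hc x) in f.
  by have [k] := scalar_weight fk f ne; lia.
pose B (a : 'I_N) (j : int) := c (a, 1 - j) * sgen F j.
exists B; have hB := cls_linear_sum fk B.
have [l4 f4 _] := cls_sub fk hX hB.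
have : (fun v => X v - linear_sum gen B v) = (fun=> 0).
  apply: (@cls1_odd 3) => [|k]; last by lia.
  split => // x.
  have -> : (fun v => X v - linear_sum gen B v) = (fun v => X v + -1 *: linear_sum gen B v).
    by apply/funext => v; rewrite scaleN1r.
  rewrite comm_addl // comm_scalel // hc comm_sum //.
  apply/funext => v; rewrite (bigD1 x.1) //= [X in _ *: (_ + X)]big1 => [|a ne]; last first.
    rewrite comm_lsum //; last exact: (locfin_linear fk).
    rewrite /lsum fsbig1 // => j _; rewrite comm_scalel // (fock_comm fk) omegaE.
    by rewrite (negbTE ne) scale0r scaler0.
  rewrite addr0 comm_lsum //; last exact: (locfin_linear fk).
  rewrite /lsum (@fsum_seq _ _ _ _ (if -1 <= 1 - x.2 then [:: 1 - x.2] else [::])).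
  - case: ifP => le.
      rewrite big_seq1 comm_scalel // (fock_comm fk) omegaE !eqxx /B subKr -surjective_pairing.
      by rewrite !scalerA -!mulrA sgen_sqr mulr1 mulN1r scaleNr subrr.
    have -> : c x = 0 by apply: contrapT => /c0; rewrite le.
    by rewrite scale0r big_nil scaler0 addr0.
  - by case: ifP.
  - by move=> i; case: ifP => // le; rewrite inE => /eqP ->.
  - move=> j /= j1 nin; rewrite comm_scalel // (fock_comm fk) omegaE eqxx /=.
    case: eqP => [e|_]; last by rewrite scale0r scaler0.
    by move: nin; rewrite -e j1 inE eqxx.
move=> h; apply/funext => v; apply/eqP; rewrite -subr_eq0; apply/eqP.
exact: (congr1 (fun B : V -> V => B v) h).
Qed.

Lemma cubic_form X : cls 4 3 X ->
  exists A B, X = (fun v => cubic_sum gen A v + linear_sum gen B v).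
Proof.
move=> /cubic_part [A /odd_quadratic_linear/linear_part [B e]]; exists A, B.
apply/funext => v; have := congr1 (fun A : V -> V => A v) e; rewrite /= => <-.
by rewrite addrC subrK.
Qed.

End CubicForm.

(** * Conjugation, and inversion of the constraints *)

Section Inversion.

Variables (F : fieldType) (V : lmodType F) (N : nat).
Variables (one : V) (gen : 'I_N * int -> V -> V) (Fil : int -> V -> Prop).
Hypothesis fk : fock one gen Fil.
Hypothesis F0 : forall n : nat, n.+1%:R != 0 :> F.
Local Notation cls := (cls gen Fil).
Local Notation Fop := (Fop Fil).
Implicit Types (A B G X : V -> V) (v : V).

(** Fixing [one] is recorded because the conjugated dimension operator must still annihilate it for
    [quadratic_form] to apply. *)
Record conjugator A B : Prop := Conjugator {
  conj_linl : lin A;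
  conj_linr : lin B;
  conjK : A \o B = id;
  conjKV : B \o A = id;
  conj_one : A one = one;
  conj_oneV : B one = one;
  conj_cls : forall d e X, cls d e X -> cls d e (A \o X \o B) }.

Lemma conjugator_id : conjugator id id.
Proof. by split. Qed.

Lemma conjugator_comp A B A' B' :
  conjugator A B -> conjugator A' B' -> conjugator (A \o A') (B' \o B).
Proof.
move=> [lA lB AB BA A1 B1 h] [lA' lB' AB' BA' A1' B1' h'].
have p1 v := congr1 (fun f : V -> V => f v) AB.
have p2 v := congr1 (fun f : V -> V => f v) BA.
have p3 v := congr1 (fun f : V -> V => f v) AB'.
have p4 v := congr1 (fun f : V -> V => f v) BA'.
split; try exact: lin_comp.
- by apply/funext => v /=; rewrite [A' _]p3 [LHS]p1.
- by apply/funext => v /=; rewrite [B _]p2 [LHS]p4.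
- by rewrite /= A1'.
- by rewrite /= B1.
- by move=> d e X hX; apply: h (h' _ _ _ hX).
Qed.

Lemma conjugator_exp G : cls 3 (- 2) G ->
  conjugator (oexp G) (oexp (fun v => -1 *: G v)).
Proof.
move=> hG; have [lG fG _] := hG.
have hG' : cls 3 (- 2) (fun v => -1 *: G v) by apply: (cls_scale fk).
have [lG' fG' _] := hG'; have K := oexp_inv fk F0 lG fG.
split; try (by apply: (lin_oexp fk)); try (by apply: (oexp_one fk)) => //.
- exact: K.
- have e : (fun v => -1 *: (-1 *: G v)) = G.
    by apply/funext => v; rewrite scalerA mulrNN mulr1 scale1r.
  by have := oexp_inv fk F0 lG' fG'; rewrite e.
- move=> d e X hX; have [Y hY e1] := oexp_conj fk F0 hG hX.
  by rewrite e1 -compA K.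
Qed.

Lemma power_series_inverse (gamma : nat -> F) : gamma 0%N = 1 ->
  exists d : nat -> F, forall n, \sum_(i < n.+1) d i * gamma (n - i)%N = (n == 0)%N%:R.
Proof.
(* Each coefficient depends on all earlier ones, so the recursion builds the list of the first n
   coefficients. *)
move=> g0; pose fix ds (n : nat) : seq F := if n is n'.+1 then
  rcons (ds n') ((n' == 0)%N%:R - \sum_(i < n') (ds n')`_i * gamma (n' - i)%N) else [::].
have sz n : size (ds n) = n by elim: n => //= n IH; rewrite size_rcons IH.
have st m i : (i < m)%N -> (ds m)`_i = (ds i.+1)`_i.
  elim: m => // m IH; rewrite ltnS leq_eqVlt => /orP[/eqP -> //|lt].
  by rewrite -IH // [LHS]nth_rcons sz lt.
exists (fun n => (ds n.+1)`_n) => n.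
rewrite big_ord_recr /= subnn g0 mulr1 nth_rcons sz ltnn eqxx.
rewrite addrC -addrA [X in _ + X](_ : _ = 0) ?addr0 //.
apply/eqP; rewrite addrC subr_eq0; apply/eqP; apply: eq_bigr => i _.
by rewrite -[rcons _ _]/(ds i.+1) (st n i).
Qed.

(** With S the shift j -> j + 1, the hypothesis reads gamma(S) D w = M v, and it is solved by the
    inverse series in S. [K] is built from [gamma] and [M] alone, hence the same for all [v] and
    [w]. *)
Lemma constraint_inversion (e f : int) (gamma : nat -> F) (D M : nat -> V -> V) :
  gamma 0%N = 1 ->
  (forall j, cls 2 (f - 2 * j%:Z) (D j)) -> (forall j, cls 3 (e - 2 * j%:Z) (M j)) ->
  exists2 K : nat -> V -> V, (forall j, cls 3 (e - 2 * j%:Z) (K j)) &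
    forall v w : V,
      (forall j, \sum_(t \in [set: nat]) gamma t *: D (j + t)%N w = M j v) ->
      forall j, D j w = K j v.
Proof.
move=> g0 hD hM; have [d hd] := power_series_inverse g0.
exists (fun j => lsum [set: nat] (fun l v => d l *: M (j + l)%N v)).
  move=> j; apply: (cls_lsum_nat fk) => l; apply: (cls_scale fk).
  by apply: cls_eq (hM (j + l)%N); lia.
move=> v w h j; have [b hb] := Fop_vanish fk v; have [b' hb'] := Fop_vanish fk w.
pose K := (b + b' + absz e + absz f).+1.
have D0 k : (K <= k)%N -> D k w = 0.
  by have [lD fD _] := hD k => le; apply: (hb' _ _ lD fD); rewrite /K in le; lia.
have M0 k : (K <= k)%N -> M k v = 0.
  by have [lD fD _] := hM k => le; apply: (hb _ _ lD fD); rewrite /K in le; lia.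
rewrite /lsum (@fsum_nat _ _ K) => [|l le]; last by rewrite M0 ?scaler0 //; lia.
transitivity (\sum_(l < K) \sum_(t < K) (d l * gamma t) *: D (j + (l + t))%N w).
  rewrite (@triangle_sum _ _ (fun l t => (d l * gamma t) *: D (j + (l + t))%N w)).
    rewrite big_ord_recl big_ord1 /= addn0 (_ : d _ * _ = 1) ?scale1r; last first.
      by have := hd 0%N; rewrite big_ord1.
    rewrite big1 ?addr0 // => n _.
    transitivity ((\sum_(i < (bump 0 n).+1) d i * gamma (bump 0 n - i)%N) *: D (j + bump 0 n)%N w).
      by rewrite scaler_suml; apply: eq_bigr => i _; rewrite subnKC // -ltnS.
    by rewrite hd /bump leq0n add1n scale0r.
  by move=> l t le; rewrite D0 ?scaler0 //; lia.
apply: eq_bigr => l _; rewrite -h (@fsum_nat _ _ K) => [|t le]; last first.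
  by rewrite D0 ?scaler0 //; lia.
by rewrite scaler_sumr; apply: eq_bigr => t _; rewrite scalerA addnA.
Qed.

End Inversion.

(** * The polynomial Fock space *)

Section PolynomialFock.

Variables (F : fieldType) (N : nat).
Hypothesis F0 : forall n : nat, n.+1%:R != 0 :> F.
Local Notation mon := {cmonom ('I_N * nat)%type}.
Local Notation Tpoly := (Tpoly F N).
Implicit Types (m : mon) (p q : Tpoly).

(** The operators J without their double factorials, so that nonzero pairings are 1 or -1; [Jscale]
    restores the normalisation. *)
Definition Tgen (x : 'I_N * int) : Tpoly -> Tpoly :=
  match x.2 with
  | Posz n.+1 => diffT x.1 (Posz n)
  | Posz 0 => mulT x.1 (Posz 0)
  | Negz n => mulT x.1 (Posz n.+1)
  end.

Definition Tfil (w : int) p : Prop :=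
  forall m, p@_m != 0 -> exists k : nat, w = (wt m)%:Z + 2 * k%:Z.

Definition Tone : Tpoly := << 1%M >>.

Lemma mcoeffL c p q m : (c *: p + q)@_m = c * p@_m + q@_m.
Proof. by rewrite (mcoeffD m (c *: p) q) (mcoeffZ c p m). Qed.

Lemma lin_mul q : lin (fun p : Tpoly => q * p).
Proof. by move=> c u v; rewrite mulrDr scalerAr. Qed.

Lemma lin_mulT a k : lin (@mulT F N a k).
Proof. by case: k => n; [exact: lin_mul|exact: lin_zero]. Qed.

Lemma lin_diffT a k : lin (@diffT F N a k).
Proof.
case: k => n; last exact: lin_zero.
move=> c p q; apply/malgP => m.
rewrite (mcoeff_diffT _ _ (c *: p + q)) (mcoeffL c p) (mcoeffL c (diffT _ _ p)).
rewrite mulrnDl -mulrnAr; congr (_ * _ + _); exact/esym/mcoeff_diffT.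
Qed.

Lemma lin_Tgen x : lin (Tgen x).
Proof.
by case: x => a [[|n]|n]; [exact: lin_mulT|exact: lin_diffT|exact: lin_mulT].
Qed.

Lemma malgUZ (c : F) m : << c *g m >> = c *: (<< m >> : Tpoly).
Proof.
apply/malgP => k; transitivity (c * (m == k)%:R); first by rewrite mcoeffU mulr_natr.
by symmetry; transitivity (c * (<< m >> : Tpoly)@_k); [exact: mcoeffZ|rewrite mcoeffU].
Qed.

Lemma lin_ext0 (A : Tpoly -> Tpoly) : lin A -> (forall m, A << m >> = 0) -> A = (fun=> 0).
Proof.
move=> lA h; apply/funext => p.
have -> : p = \sum_(k <- msupp p) p@_k *: << k >>.
  by rewrite {1}[p]monalgE; apply: eq_bigr => k _; exact: malgUZ.
by rewrite (lin_sum _ _ _ lA) big1 // => k _; rewrite (linZ _ _ lA) h scaler0.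
Qed.

Lemma diffT_mulT a b i j :
  comm (@diffT F N a (Posz i)) (mulT b (Posz j)) = (fun p => ((a, i) == (b, j))%:R *: p).
Proof.
apply/funext => p; apply/malgP => m.
have e1 : (diffT a (Posz i) (mulT b (Posz j) p))@_m =
    (if (ucm (a, i) * m)%M (b, j) == 0%N then 0 else
      p@_(divcm (ucm (a, i) * m)%M (ucm (b, j)))) *+ (m (a, i)).+1.
  transitivity ((mulT b (Posz j) p)@_(ucm (a, i) * m)%M *+ (m (a, i)).+1).
    exact: mcoeff_diffT.
  by congr (_ *+ _); exact: mcoeff_mulT.
have e2 : (mulT b (Posz j) (diffT a (Posz i) p))@_m =
    if m (b, j) == 0%N then 0 else
      p@_(ucm (a, i) * divcm m (ucm (b, j)))%M *+ (divcm m (ucm (b, j)) (a, i)).+1.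
  transitivity (if m (b, j) == 0%N then 0 else
      (diffT a (Posz i) p)@_(divcm m (ucm (b, j)))); first exact: mcoeff_mulT.
  by case: ifP => // _; exact: mcoeff_diffT.
transitivity (((a, i) == (b, j))%:R * p@_m); last by symmetry; exact: mcoeffZ.
transitivity ((diffT a (Posz i) (mulT b (Posz j) p))@_m -
  (mulT b (Posz j) (diffT a (Posz i) p))@_m); first exact: mcoeffB.
etransitivity; first exact: (congr2 (fun u v : F => u - v) e1 e2).
move=> {e1 e2}; rewrite cmM cmU.
case: (eqVneq (a, i) (b, j)) => [<-|ne].
  rewrite ucmMK ?eqxx add1n /= mul1r; have [->|mx] := eqVneq (m (a, i)) 0%N.
    by rewrite subr0 mulr1n.
  by rewrite (divcmK mx) divcmE cmUU subn1 prednK ?lt0n // -mulrnBr ?subSnn.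
rewrite mul0r add0n; have [mx|mx] := eqVneq (m (b, j)) 0%N.
  by rewrite mul0rn subr0.
rewrite divcmE cmU [(b, j) == _]eq_sym (negbTE ne) subn0.
have -> : (divcm (ucm (a, i) * m) (ucm (b, j)) =
           ucm (a, i) * divcm m (ucm (b, j)))%M.
  apply/eqP/cmP => k; rewrite !(divcmE, cmM, cmU).
  by case: (eqVneq (b, j) k) => [<-|_]; rewrite ?subn0 // (negbTE ne) !add0n.
by rewrite subrr.
Qed.

Lemma mulT_mulT a b i j :
  comm (@mulT F N a (Posz i)) (mulT b (Posz j)) = (fun=> 0).
Proof.
have e (A : comPzRingType) (u v w : A) : u * (v * w) - v * (u * w) = 0.
  by rewrite mulrCA subrr.
by apply/funext => p; exact: (e Tpoly).
Qed.

Lemma diffT_diffT a b i j :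
  comm (@diffT F N a (Posz i)) (diffT b (Posz j)) = (fun=> 0).
Proof.
apply/funext => p; apply/malgP => m.
have e c d k l : (diffT c (Posz k) (diffT d (Posz l) p))@_m =
    p@_(ucm (d, l) * (ucm (c, k) * m))%M *+ ((ucm (c, k) * m)%M (d, l)).+1
      *+ (m (c, k)).+1.
  transitivity ((diffT d (Posz l) p)@_(ucm (c, k) * m)%M *+ (m (c, k)).+1).
    exact: mcoeff_diffT.
  by congr (_ *+ _); exact: mcoeff_diffT.
transitivity ((diffT a (Posz i) (diffT b (Posz j) p))@_m -
  (diffT b (Posz j) (diffT a (Posz i) p))@_m); first exact: mcoeffB.
transitivity (0 : F); last by symmetry; exact: mcoeff0.
etransitivity; first exact: (congr2 (fun u v : F => u - v) (e _ _ _ _) (e _ _ _ _)).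
rewrite !mulmA [(ucm (b, j) * _)%M]mulmC !cmM !cmU [(b, j) == _]eq_sym.
by case: eqVneq => [->|_]; rewrite ?subrr // !add0n -!mulrnA mulnC subrr.
Qed.

Lemma Tgen_comm x y : comm (Tgen x) (Tgen y) = (fun p => omega F x y *: p).
Proof.
have om0 z t : ((z.1 == t.1) && (z.2 + t.2 == 1)) = false ->
    (fun p => omega F z t *: p) = (fun=> 0 : Tpoly).
  by move=> h; apply/funext => p; rewrite /omega h scale0r.
have swap A B (c : F) : comm B A = (fun p : Tpoly => c *: p) ->
    comm A B = (fun p => - c *: p).
  move=> h; apply/funext => p; have := congr1 (fun f : Tpoly -> Tpoly => - f p) h.
  by rewrite scaleNr => <-; rewrite opprB.
have sc (c d : F) : c = d -> (fun p : Tpoly => c *: p) = (fun p => d *: p) by move=> ->.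
case: x y => a [[|n]|n] [b [[|k]|k]].
- etransitivity; first exact: (mulT_mulT a b 0 0).
  by symmetry; apply: om0; rewrite /= andbF.
- etransitivity; first exact: (swap _ _ _ (diffT_mulT b a k 0)).
  apply: sc; rewrite /omega /= xpair_eqE [b == a]eq_sym.
  by case: (a == b); case: k => [|k]; rewrite ?oppr0.
- etransitivity; first exact: (mulT_mulT a b 0 k.+1).
  by symmetry; apply: om0; rewrite /= andbF.
- etransitivity; first exact: (diffT_mulT a b n 0).
  apply: sc; rewrite /omega /= xpair_eqE.
  by case: (a == b); case: n => [|n].
- etransitivity; first exact: (diffT_diffT a b n k).
  by symmetry; apply: om0; apply/negbTE; rewrite negb_and; apply/orP; right => /=; lia.
- etransitivity; first exact: (diffT_mulT a b n k.+1).
  apply: sc; rewrite /omega /= xpair_eqE.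
  have -> : (n.+1%:Z + Negz k == 1) = (n == k.+1) by lia.
  by case: ifP.
- etransitivity; first exact: (mulT_mulT a b n.+1 0).
  by symmetry; apply: om0; apply/negbTE; rewrite negb_and; apply/orP; right => /=; lia.
- etransitivity; first exact: (swap _ _ _ (diffT_mulT b a k n.+1)).
  apply: sc; rewrite /omega /= xpair_eqE [b == a]eq_sym.
  have -> : (Negz n + k.+1%:Z == 1) = (k == n.+1) by lia.
  by case: ifP => _; rewrite ?oppr0.
- etransitivity; first exact: (mulT_mulT a b n.+1 k.+1).
  by symmetry; apply: om0; apply/negbTE; rewrite negb_and; apply/orP; right => /=; lia.
Qed.

Lemma Tgen_cre a (n : nat) : Tgen (a, - n%:Z) = mulT a n.
Proof. by case: n. Qed.

Lemma Tfil_mulT w a (n : nat) p : Tfil w p -> Tfil (w + (1 + 2 * n%:Z)) (mulT a n p).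
Proof.
move=> h m; rewrite mcoeff_mulT; have [//|mx] := eqVneq (m (a, n)) 0%N; first by rewrite eqxx.
move=> /h [k ->]; exists k; rewrite -{2}(divcmK mx) wtM wtU /=; lia.
Qed.

Lemma Tfil_diffT w a (n : nat) p : Tfil w p -> Tfil (w - (1 + 2 * n%:Z)) (diffT a n p).
Proof.
move=> h m; rewrite mcoeff_diffT => ne.
have /h [k ->] : p@_(ucm (a, n) * m)%M != 0.
  by apply: contraNneq ne => ->; rewrite mul0rn.
by exists k; rewrite wtM wtU /=; lia.
Qed.

Lemma Tfock : fock Tone Tgen Tfil.
Proof.
split.
- exact: lin_Tgen.
- exact: Tgen_comm.
(* Monomials arise from 1 by multiplying by variables, so commuting with these multiplications
   carries A 1 = 0 to every monomial. *)
- move=> A lA h A1.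
  apply: (lin_ext0 lA).
  apply: cmonom_ind => [|[a n] m IH].
    exact: A1.
  have := comm0_apply (lin_Tgen (a, - n%:Z)) (h a n) IH.
  rewrite Tgen_cre; congr (A _ = 0).
  transitivity (<< 1 * 1 *g (ucm (a, n) * m)%M >> : Tpoly); last by rewrite mulr1.
  exact: fgmulUU.
(* If a variable x divides m, the coefficient of m reappears in the derivative by x times a positive
   integer, which is invertible in F. *)
- move=> p h; exists (p@_1%M); apply/malgP => m.
  transitivity (p@_1%M * (1%M == m)%:R); last first.
    symmetry; transitivity (p@_1%M * Tone@_m); first exact: mcoeffZ.
    by congr (_ * _); exact: mcoeffU1.
  case: (eqVneq 1%M m) => [<-|ne]; first by rewrite mulr1.
  rewrite mulr0; have [x mx] : exists x, m x != 0%N.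
    apply: contrapT => hx; case/eqP: ne; apply/eqP/cmP => x; rewrite cm1.
    by apply/esym/eqP/negPn/negP => hx'; apply: hx; exists x.
  have e : (diffT x.1 x.2 p)@_(divcm m (ucm x)) = 0.
    transitivity ((0 : Tpoly)@_(divcm m (ucm x))); last exact: mcoeff0.
    exact: (congr1 (mcoeff (divcm m (ucm x))) (h x.1 x.2)).
  have := etrans (esym (mcoeff_diffT x.1 x.2 p (divcm m (ucm x)))) e.
  rewrite -surjective_pairing divcmK // => /eqP.
  by rewrite -mulr_natr mulf_eq0 (negbTE (F0 _)) orbF => /eqP.
- move=> e; have : (1 : F) = 0.
    transitivity (Tone@_1%M); first by symmetry; exact: mcoeffUU.
    transitivity ((0 : Tpoly)@_1%M); last exact: mcoeff0.
    exact: (congr1 (mcoeff 1%M) e).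
  by move/eqP; rewrite oner_eq0.
- move=> w m; have -> : (0 : Tpoly)@_m = 0 by exact: mcoeff0.
  by rewrite eqxx.
- move=> w c u v hu hv m; have -> : (c *: u + v)@_m = c * u@_m + v@_m by exact: mcoeffL.
  move=> ne; have [um|um] := eqVneq (u@_m) 0; last exact: hu.
  by apply: hv; rewrite um mulr0 add0r in ne.
- by move=> w v h m /h [k ->]; exists k.+1; lia.
- move=> w v lt h; apply/malgP => m; transitivity (0 : F); last by symmetry; exact: mcoeff0.
  by apply/eqP/negPn/negP => /h [k]; lia.
- move=> w [a [[|n]|n]] v h.
  + have e : w + (1 + 2 * 0%:Z) = w + (1 - 2 * 0) by lia.
    by have := Tfil_mulT (a := a) (n := 0%N) h; rewrite e.
  + have e : w - (1 + 2 * n%:Z) = w + (1 - 2 * n.+1%:Z) by lia.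
    by have := Tfil_diffT (a := a) (n := n) h; rewrite e.
  + have e : w + (1 + 2 * n.+1%:Z) = w + (1 - 2 * Negz n) by lia.
    by have := Tfil_mulT (a := a) (n := n.+1) h; rewrite e.
- move=> m; have -> : Tone@_m = (1%M == m)%:R by exact: mcoeffU1.
  case: (eqVneq 1%M m) => [<-|]; last by rewrite eqxx.
  by move=> _; exists 0%N; rewrite wt1.
- move=> w /(_ 1%M); have -> : Tone@_1%M = 1 by exact: mcoeffUU.
  by rewrite oner_neq0 => /(_ isT) [k ->]; exists k; rewrite wt1; lia.
(* The sum of the weights of all monomials is a crude bound for each; the two parts separate the
   weights by parity relative to n. *)
- move=> p; pose n := (\sum_(m <- msupp p) wt m)%N.
  pose part (P : pred mon) := \sum_(m <- msupp p | P m) << p@_m *g m >>.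
  have partE P m : (part P)@_m = if P m then p@_m else 0.
    rewrite /part raddf_sum /= big_mkcond /=.
    transitivity (\sum_(k <- msupp p) (if P m then p@_k *+ (k == m) else 0)).
      apply: eq_bigr => k _; rewrite mcoeffU; case: (eqVneq k m) => [->//|_].
      by rewrite mulr0n !if_same.
    by case: (P m); [rewrite mcoeff_sum_delta|rewrite big1].
  have bnd m : p@_m != 0 -> (wt m <= n)%N.
    rewrite mcoeff_neq0 => ms; rewrite /n (big_fsetD1 _ ms) /=; exact: leq_addr.
  exists n, (part (fun m => odd (wt m) == odd n)), (part (fun m => odd (wt m) != odd n)).
  split.
  + apply/malgP => m; symmetry; etransitivity; first exact: mcoeffD.
    by rewrite !partE; case: (_ == _); rewrite ?addr0 ?add0r.
  + move=> m; rewrite partE; case: ifP => [/eqP o /bnd le|]; last by rewrite eqxx.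
    exists ((n - wt m)./2); have := odd_double_half (n - wt m); rewrite oddB // o addbb; lia.
  + move=> m; rewrite partE; case: ifP => [o /bnd le|]; last by rewrite eqxx.
    exists ((n.+1 - wt m)./2); have := odd_double_half (n.+1 - wt m).
    rewrite oddB; last by lia.
    by rewrite /=; move: o; case: (odd n); case: (odd _) => //=; lia.
Qed.

End PolynomialFock.

(** * The operators of the theorem *)

Section ModuleIdentities.

Variables (F : fieldType) (V : lmodType F).
Implicit Types (u v w : V) (g : nat -> V) (A B C : V -> V).

Lemma scale0_of c u : u = 0 -> c *: u = 0.
Proof. by move=> ->; rewrite scaler0. Qed.

Lemma scale_comp0 c A B v : lin A -> B v = 0 -> c *: A (B v) = 0.
Proof. by move=> lA ->; rewrite (lin0 lA) scaler0. Qed.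

Lemma combination0 c d u v w : u = 0 -> v = 0 -> w = 0 -> c *: u + v + d *: w = 0.
Proof. by move=> -> -> ->; rewrite !scaler0 !addr0. Qed.

Lemma scale_comp3 (c k l m : F) A B C v : lin A -> lin B -> k != 0 -> l != 0 -> m != 0 ->
  (c / (k * l * m)) *: (k *: A (l *: B (m *: C v))) = c *: A (B (C v)).
Proof.
move=> lA lB k0 l0 m0; rewrite (linZ _ _ lB) !(linZ _ _ lA) !scalerA.
by congr (_ *: _); field; rewrite k0 l0 m0.
Qed.

Lemma scale_comp1 (c k : F) v : k != 0 -> (c / k) *: (k *: v) = c *: v.
Proof. by move=> k0; rewrite scalerA divfK. Qed.

Lemma fsum_from (c K : nat) g : (forall t, (K <= t)%N -> g (c + t)%N = 0) ->
  \sum_(k \in [set k : nat | (c <= k)%N]) g k = \sum_(t < K) g (c + t)%N.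
Proof.
move=> g0; rewrite (@fsum_seq _ _ _ _ [seq (c + t)%N | t <- iota 0 K]).
- by rewrite big_map -(big_mkord xpredT (fun t => g (c + t)%N)) /index_iota subn0.
- by rewrite map_inj_uniq ?iota_uniq // => x y /addnI.
- by move=> k /mapP[t _ ->] /=; apply: leq_addr.
- move=> k /= ck kn; rewrite -(subnKC ck); apply: g0; rewrite leqNgt.
  apply: contraNN kn => lt; apply/mapP; exists (k - c)%N; last by rewrite subnKC.
  by rewrite mem_iota add0n.
Qed.

(* The Virasoro constraint multiplied by 2 s. *)
Lemma solve_constraint (s c d : F) (L D S v : V) : s != 0 -> 2 != 0 :> F ->
  2^-1 *: L - (c / (2 * s)) *: D + 2^-1 *: S + d *: v = 0 ->
  c *: D + (- s) *: S = s *: L + (2 * s * d) *: v.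
Proof.
move=> s0 t0 /(congr1 (fun u => (2 * s) *: u)) /=; rewrite scaler0 !scalerDr scalerN.
rewrite !scalerA; have -> : 2 * s / 2 = s by field.
have -> : 2 * s * (c / (2 * s)) = c by field; rewrite t0 s0.
move=> e; apply/esym/eqP; rewrite -subr_eq0 -e scaleNr opprB; apply/eqP.
by rewrite [LHS]addrAC; congr (_ + _); rewrite [LHS]addrA [LHS]addrAC.
Qed.

End ModuleIdentities.

(** * Weights, orders and inverses of the given operators *)

Section DefinedOperators.

Variables (F : fieldType) (N : nat).
Hypothesis F0 : forall n : nat, n.+1%:R != 0 :> F.
Local Notation Tpoly := (Tpoly F N).
Local Notation Top := (Top F N).
Local Notation cls := (cls (@Tgen F N) (@Tfil F N)).
Local Notation conjugator := (conjugator (@Tone F N) (@Tgen F N) (@Tfil F N)).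
Implicit Types (a b : 'I_N) (p : Tpoly) (A B : Top).

Let fk : fock (@Tone F N) (@Tgen F N) (@Tfil F N) := Tfock N F0.

Lemma cls_Tadd d e A B : cls d e A -> cls d e B -> cls d e (A + B).
Proof. exact: (cls_add fk). Qed.

Lemma cls_Tscale d e k A : cls d e A -> cls d e (k *: A).
Proof. exact: (cls_scale fk). Qed.

Lemma cls_Tsum d e (I : Type) (r : seq I) (f : I -> Top) :
  (forall i, cls d e (f i)) -> cls d e (\sum_(i <- r) f i).
Proof.
move=> h; elim/big_ind: _ => [|A B|i _]; [exact: (cls_zero fk)|exact: cls_Tadd|exact: h].
Qed.

Lemma cls_opsum d e (I : choiceType) (D : set I) (f : I -> Top) :
  locfin D f -> (forall i, D i -> cls d e (f i)) -> cls d e (opsum D f).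
Proof. exact: (cls_lsum fk). Qed.

Lemma cls_mulT a (k : int) : cls 2 (1 + 2 * k) (@mulT F N a k).
Proof.
case: k => n; last exact: (cls_zero fk).
by have := cls_gen fk (a, - n%:Z); rewrite Tgen_cre; apply: cls_eq => /=; lia.
Qed.

Lemma cls_diffT a (k : int) : cls 2 (- (1 + 2 * k)) (@diffT F N a k).
Proof.
case: k => n; last exact: (cls_zero fk).
by have := cls_gen fk (a, n.+1%:Z); apply: cls_eq => /=; lia.
Qed.

Lemma diffT_vanish p : exists n : nat, forall a (k : int), n%:Z <= k -> diffT a k p = 0.
Proof.
have [b hb] := Fop_vanish fk p; exists b => a k le; have [l f _] := cls_diffT a k.
by apply: hb l f _; lia.
Qed.

(** Infinitely many integer pairs have sum m, but terms with a negative index vanish, which leaves 0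
    <= i, j <= m. *)
Lemma locfin_pairs (m : int) (f : int * int -> Top) :
  (forall i j p, i < 0 \/ j < 0 -> f (i, j) p = 0) ->
  locfin [set ij : int * int | ij.1 + ij.2 = m] f.
Proof.
move=> f0 p; have fin := finite_int_interval (absz m).
apply: sub_finite_set (finite_setX fin fin) => -[i j] /= [e ne].
have [i0|i0] := ltP i 0; first by case: ne; apply: f0; left.
have [j0|j0] := ltP j 0; first by case: ne; apply: f0; right.
by split; apply/andP; split; lia.
Qed.

Lemma mulT_mulT_neg a (c : F) i j p : i < 0 \/ j < 0 -> c *: mulT a i (mulT a j p) = 0.
Proof.
case: i => i; case: j => j; first by case; lia.
- by move=> _; apply: scale_comp0 => //; exact: (lin_mulT a (Posz i)).
- by move=> _; exact: scale0_of.
- by move=> _; exact: scale0_of.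
Qed.

Lemma diffT_diffT_neg a (c : F) i j p : i < 0 \/ j < 0 -> c *: diffT a i (diffT a j p) = 0.
Proof.
case: i => i; case: j => j; first by case; lia.
- by move=> _; apply: scale_comp0 => //; exact: (lin_diffT a (Posz i)).
- by move=> _; exact: scale0_of.
- by move=> _; exact: scale0_of.
Qed.

Lemma locfin_mulT_diffT a b (c : nat -> F) (e : nat -> int) (l : nat) :
  (forall k : nat, k%:Z - l%:Z <= e k) ->
  locfin [set: nat] (fun k => c k *: (@mulT F N a k \o diffT b (e k)) : Top).
Proof.
move=> he p; have [n hn] := diffT_vanish p.
apply: (@sub_finite_set _ _ `I_(n + l)); last exact: finite_II.
move=> k [_ ne] /=; rewrite ltnNge; apply/negP => le; apply: ne.
have le' : n%:Z <= e k by have := he k; lia.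
exact: (scale_comp0 (c k) (lin_mulT a k) (hn b _ le')).
Qed.

Lemma cls_Lop a (m : int) : cls 3 (- (2 * m)) (@Lop F N a m).
Proof.
apply: cls_Tadd; first apply: cls_Tadd.
- apply/cls_Tscale/cls_opsum.
    by apply: locfin_pairs => i j p; exact: mulT_mulT_neg.
  move=> [i j] /= e; apply: cls_Tscale.
  by apply: cls_eq (cls_comp fk (cls_mulT a i) (cls_mulT a j)); lia.
- apply: cls_opsum.
    by apply: (@locfin_mulT_diffT _ _ _ _ (absz m)) => k; lia.
  move=> k _; apply: cls_Tscale.
  by apply: cls_eq (cls_comp fk (cls_mulT a k) (cls_diffT a (k%:Z + m))); lia.
- apply/cls_Tscale/cls_opsum.
    by apply: locfin_pairs => i j p; exact: diffT_diffT_neg.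
  move=> [i j] /= e; apply: cls_Tscale.
  by apply: cls_eq (cls_comp fk (cls_diffT a i) (cls_diffT a j)); lia.
Qed.

(** The middle sum has its derivative on the right; in the other two i + j = -1 forces a negative
    index. *)
Lemma Lop0_one a : Lop a 0 (Tone F N) = 0.
Proof.
apply: combination0.
- apply: fsbig1 => -[i j] /= e; apply: mulT_mulT_neg; lia.
- apply: fsbig1 => k _; apply: (scale_comp0 _ (lin_mulT a k)).
  by rewrite addr0; exact: (gen_one fk a k).
- apply: fsbig1 => -[i j] /= e; apply: diffT_diffT_neg; lia.
Qed.

Lemma cls_opsum_from1 d (f : nat -> Top) :
  (forall k, cls d (0 - 2 * k%:Z) (f k)) ->
  cls d (- 2) (opsum [set k : nat | (1 <= k)%N] f).
Proof.
move=> h; apply: cls_opsum => [|k /= k1].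
  by apply: (@locfin_nat _ _ _ _ _ _ fk 0) => k; case: (h k).
by apply: (cls_weaken fk) (h k); exists k.-1; lia.
Qed.

Lemma cls_givental (r : nat -> 'M[F]_N) : cls 3 (- 2) (givental_log r).
Proof.
apply: cls_opsum_from1 => k; apply: cls_Tsum => a; apply: cls_Tsum => b.
apply: cls_Tadd.
  apply: cls_opsum.
    by apply: (@locfin_mulT_diffT _ _ _ _ 0) => j; lia.
  move=> j _; apply: cls_Tscale.
  by apply: cls_eq (cls_comp fk (cls_mulT a j) (cls_diffT b (k%:Z + j%:Z))); lia.
apply: cls_Tscale; apply: cls_Tsum => j; apply: cls_Tscale.
by apply: cls_eq (cls_comp fk (cls_diffT a j%:Z) (cls_diffT b (k%:Z - j%:Z - 1))); lia.
Qed.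

Lemma conjugator_opexp A : cls 3 (- 2) A -> exists B, conjugator (opexp A) B.
Proof. by move=> h; exists (oexp (fun p => -1 *: A p)); exact: (conjugator_exp fk F0 h). Qed.

Lemma conjugator_Rop (r : nat -> 'M[F]_N) : exists B, conjugator (Rop r) B.
Proof. exact/conjugator_opexp/cls_givental. Qed.

Lemma conjugator_Vop (chi : 'I_N -> nat -> F) : exists B, conjugator (Vop chi) B.
Proof.
rewrite /Vop; elim/big_ind: _ => [|A A' [B hB] [B' hB']|a _].
- by exists id; exact: conjugator_id.
- by exists (B' \o B); exact: conjugator_comp.
- apply/conjugator_opexp/cls_opsum_from1 => k; apply: cls_Tscale.
  by apply: cls_eq (cls_Lop a k); lia.
Qed.

Lemma opinvE A B : conjugator A B -> opinv A = B.
Proof.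
move=> h; have AB p : A (B p) = p := congr1 (fun f : Tpoly -> Tpoly => f p) (conjK h).
have BA p : B (A p) = p := congr1 (fun f : Tpoly -> Tpoly => f p) (conjKV h).
have injA : {in [set: Tpoly] &, injective A}.
  by move=> p q _ _ e; rewrite -[p]BA -[q]BA e.
have := @pinvKV _ _ (fun=> 0) [set: Tpoly] A injA => K; apply/funext => p.
transitivity (opinv A (A (B p))); first by rewrite AB.
by apply: K; rewrite inE.
Qed.

Definition Jscale (k : int) : F :=
  if 0 < k then dfact F (2 * k - 1) else (dfact F (2 * `|k| - 1))^-1.

Lemma dfact_neq0 n : dfact F n != 0.
Proof.
case: n => n; last exact: oner_neq0.
by rewrite /dfact; apply/prodf_neq0 => -[[|i] lt] // _; exact: F0.
Qed.

Lemma Jscale_neq0 k : Jscale k != 0.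
Proof. by rewrite /Jscale; case: ifP => _; rewrite ?invr_eq0 dfact_neq0. Qed.

Lemma JopE a k : Jop a k = (fun p => Jscale k *: Tgen (a, k) p).
Proof.
case: k => [[|n]|n]; apply/funext => p.
- reflexivity.
- transitivity (dfact F (2 * n.+1%:Z - 1) *: diffT a (n.+1%:Z - 1) p); first reflexivity.
  have -> : n.+1%:Z - 1 = n by lia.
  reflexivity.
- reflexivity.
Qed.

Lemma TopsumE (I : Type) (r : seq I) (P : pred I) (f : I -> Top) p :
  (\sum_(i <- r | P i) f i) p = \sum_(i <- r | P i) f i p.
Proof. exact: (big_morph (fun A : Top => A p)). Qed.

Lemma WopE (A : 'I_N -> 'I_N -> 'I_N -> int -> int -> int -> F) (B : 'I_N -> int -> F) :
  @Wop F N (fun a b c i j k => A a b c i j k / (Jscale i * Jscale j * Jscale k))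
    (fun a j => B a j / Jscale j) =
  (fun p => cubic_sum (@Tgen F N) A p + linear_sum (@Tgen F N) B p).
Proof.
have lg := @lin_Tgen F N.
apply/funext => p; congr (_ + _).
  etransitivity; first exact: TopsumE; apply: eq_bigr => a _.
  etransitivity; first exact: TopsumE; apply: eq_bigr => b _.
  etransitivity; first exact: TopsumE; apply: eq_bigr => c _.
  apply: eq_fsbigr => -[[i j] k] _; rewrite !JopE /=.
  by apply: scale_comp3; rewrite ?Jscale_neq0.
etransitivity; first exact: TopsumE; apply: eq_bigr => a _.
apply: eq_fsbigr => j _; rewrite JopE.
by apply: scale_comp1; exact: Jscale_neq0.
Qed.

End DefinedOperators.

(** * Solving the constraints for R^(-1) Z *)

Section CutAndJoin.

Variables (F : fieldType) (N : nat).
Hypothesis F0 : forall n : nat, n.+1%:R != 0 :> F.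
Local Notation Tpoly := (Tpoly F N).
Local Notation Top := (Top F N).
Local Notation cls := (cls (@Tgen F N) (@Tfil F N)).
Variables (alpha : 'I_N -> nat) (r : nat -> 'M[F]_N) (DeltaT : 'I_N -> nat -> F).
Variables (s : 'I_N -> F) (chi : 'I_N -> nat -> F).
Hypothesis s0 : forall a, s a != 0.
Hypothesis alpha1 : forall a, (alpha a <= 1)%N.

Let fk : fock (@Tone F N) (@Tgen F N) (@Tfil F N) := Tfock N F0.
Let two0 : 2 != 0 :> F. Proof. exact: (F0 1). Qed.

(** After multiplication by 2 s, and up to the factor 1/hbar, the derivative terms of the constraint
    m = j - alpha are minus the sum over t = k - alpha of these coefficients times [oddD a (j + t)].
    The factor (2m + 2k + 1)!! depends only on j + t and is absorbed in [oddD], so the series is the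
    same for all j; its unit term is the dilaton shift. *)
Definition dilaton_series a (t : nat) : F :=
  if t == 0%N then 1
  else - (s a * DeltaT a (alpha a + t)%N / dfact F (2 * (alpha a + t)%N%:Z - 1)).

Definition oddD a (j : nat) : Tpoly -> Tpoly :=
  fun p => dfact F (2 * j%:Z + 1) *: diffT a j p.

Definition virM a (j : nat) : Tpoly -> Tpoly := fun p =>
  s a *: Lop a (j%:Z - (alpha a)%:Z) p
  + (2 * s a * ((j%:Z - (alpha a)%:Z == 0)%:R / 16)) *: p.

Lemma cls_oddD a j : cls 2 (- 1 - 2 * j%:Z) (oddD a j).
Proof. by apply: (cls_scale fk); apply: cls_eq (cls_diffT F0 a j); lia. Qed.

Lemma cls_virM a j : cls 3 (2 * (alpha a)%:Z - 2 * j%:Z) (virM a j).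
Proof.
apply: (cls_add fk).
  by apply: (cls_scale fk); apply: cls_eq (cls_Lop F0 a _); lia.
have [e|ne] := eqVneq (j%:Z - (alpha a)%:Z) 0.
  have h := cls_S fk (cls_S fk (cls_id (@Tgen F N) (@Tfil F N))).
  by apply: (cls_scale fk); apply: cls_eq h; lia.
have c0 : 2 * s a * (false%:R / 16) = 0 by rewrite mul0r mulr0.
rewrite c0; apply: (eq_ind _ (cls 3 _) (cls_zero fk _ _)).
by apply/funext => p; exact/esym/scale0r.
Qed.

(** Terms with 1/hbar read coefficient n + 1 of the series and the others coefficient n; this shift
    replaces the factor hbar. *)
Lemma constraint_series a (j : nat) (y : hser F N) (n : int) :
  Lambda alpha s DeltaT a (j%:Z - (alpha a)%:Z) y n = 0 ->
  \sum_(t \in [set: nat]) dilaton_series a t *: oddD a (j + t) (y (n + 1))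
  = virM a j (y n).
Proof.
set m := j%:Z - _ => e; set w := y (n + 1).
pose g (k : nat) := (dfact F (2 * m + 2 * k%:Z + 1) / dfact F (2 * k%:Z - 1) * DeltaT a k)
  *: diffT a (m + k%:Z) w.
have := @solve_constraint _ _ (s a) (dfact F (2 * m + 2 * (alpha a)%:Z + 1))
  ((m == 0)%:R / 16) (Lop a m (y n)) (diffT a (m + (alpha a)%:Z) w)
  (\sum_(k \in [set k | (1 + alpha a <= k)%N]) g k) (y n) (s0 a) two0 e.
rewrite /virM -/m => <-.
have [b hb] := diffT_vanish F0 w.
have D0 k : (b <= k)%N -> diffT a k%:Z w = 0 by move=> le; apply: hb; lia.
have S1 : \sum_(t \in [set: nat]) dilaton_series a t *: oddD a (j + t) w =
    \sum_(t < b.+1) dilaton_series a t *: oddD a (j + t) w.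
  apply: fsum_nat => t le; apply: scale0_of; apply: scale0_of; apply: D0; lia.
have S2 : \sum_(k \in [set k | (1 + alpha a <= k)%N]) g k =
    \sum_(t < b) g (1 + alpha a + t)%N.
  by apply: fsum_from => t le; apply: scale0_of; apply: hb; lia.
have P1 : dilaton_series a 0 *: oddD a (j + 0) w =
    dfact F (2 * m + 2 * (alpha a)%:Z + 1) *: diffT a (m + (alpha a)%:Z) w.
  rewrite /dilaton_series eqxx; etransitivity; first exact: scale1r.
  rewrite addn0 /oddD /m.
  have -> : j%:Z - (alpha a)%:Z + (alpha a)%:Z = j by lia.
  by have -> : 2 * (j%:Z - (alpha a)%:Z) + 2 * (alpha a)%:Z + 1 = 2 * j%:Z + 1 by lia.
have P2 : \sum_(t < b) dilaton_series a (bump 0 t) *: oddD a (j + bump 0 t) w =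
    (- s a) *: \sum_(k \in [set k | (1 + alpha a <= k)%N]) g k.
  symmetry; etransitivity; first exact: (congr1 (fun u : Tpoly => (- s a) *: u) S2).
  etransitivity; first exact: scaler_sumr.
  symmetry; apply: eq_bigr => t _.
  rewrite /bump leq0n add1n /dilaton_series /oddD /g.
  have -> : m + (1 + alpha a + t)%N%:Z = (j + t.+1)%N by lia.
  have -> : 2 * m + 2 * (1 + alpha a + t)%N%:Z + 1 = 2 * (j + t.+1)%N%:Z + 1 by lia.
  have -> : (1 + alpha a + t)%N = (alpha a + t.+1)%N by lia.
  etransitivity; first exact: scalerA.
  symmetry; etransitivity; first exact: scalerA.
  have key : - s a * (dfact F (2 * (j + t.+1)%N%:Z + 1) /
      dfact F (2 * (alpha a + t.+1)%N%:Z - 1) * DeltaT a (alpha a + t.+1)%N) =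
    - (s a * DeltaT a (alpha a + t.+1)%N / dfact F (2 * (alpha a + t.+1)%N%:Z - 1))
      * dfact F (2 * (j + t.+1)%N%:Z + 1) by ring.
  exact: (congr1 (fun u : F => u *: diffT a (j + t.+1)%N w) key).
etransitivity; first exact: S1.
etransitivity; first exact: big_ord_recl.
exact: (congr2 (fun u v : Tpoly => u + v) P1 P2).
Qed.

Lemma cut_and_join_exists :
  exists (A : 'I_N -> 'I_N -> 'I_N -> int -> int -> int -> F) (B : 'I_N -> int -> F),
  forall Z : nat -> Tpoly,
    (forall a (m : int), - (alpha a)%:Z <= m ->
       forall n, Vir alpha r s DeltaT a m (hser_of Z) n = 0) ->
    (forall n, hbar (hdiff (hser_of Z)) n
               = hlift (Hop alpha r chi) (hser_of Z) n) ->
    forall n, hdiff (hser_of Z) n = hlift (Wop A B) (hser_of Z) n.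
Proof.
have [Ri hR] := conjugator_Rop F0 r; have [Vi hV] := conjugator_Vop F0 chi.
pose D : Top := \sum_(a < N) (2 * alpha a + 1)%N%:R^-1 *: Lop a 0.
have hD : cls 3 0 D.
  apply: (cls_Tsum F0) => a; apply: (cls_Tscale F0).
  by apply: cls_eq (cls_Lop F0 a 0); lia.
have D1 : D (Tone F N) = 0.
  etransitivity; first exact: TopsumE; apply: big1 => a _.
  by apply: scale0_of; exact: (Lop0_one F0).
have hQ := conj_cls hV hD; set Q := _ \o _ \o _ in hQ.
have Q1 : Q (Tone F N) = 0.
  by rewrite /Q /= (conj_oneV hV) D1; exact: (lin0 (conj_linl hV)).
have [U hU QU] := quadratic_form fk F0 hQ Q1.
(* The inverted operators are fixed before [Z] is introduced, so the final [A] and [B] do not depend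
   on it. *)
have /boolp.choice [K hK] : forall a, exists K : nat -> Tpoly -> Tpoly,
    (forall j, cls 3 (2 * (alpha a)%:Z - 2 * j%:Z) (K j)) /\
    forall v w : Tpoly,
      (forall j, \sum_(t \in [set: nat]) dilaton_series a t *: oddD a (j + t) w
         = virM a j v) -> forall j, oddD a j w = K j v.
  move=> a; have [|K h1 h2] := @constraint_inversion _ _ _ _ _ _ fk
    (2 * (alpha a)%:Z) (-1) (dilaton_series a) (oddD a) (virM a) _ (cls_oddD a) (cls_virM a).
    by rewrite /dilaton_series eqxx.
  by exists K.
pose K' (x : 'I_N * nat) : Tpoly -> Tpoly :=
  fun p => (dfact F (2 * x.2%:Z + 1))^-1 *: K x.1 x.2 p.
have hK' x : cls 3 (2 * (alpha x.1)%:Z - 2 * x.2%:Z) (K' x).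
  by apply: (cls_scale fk); have [h _] := hK x.1.
(* For x = (a, k) the bounds 1 + 2k and 2 alpha_a - 2k add up to 1 + 2 alpha_a, which differs from 3
   by the even number 2(1 - alpha_a). *)
have hUK x : cls 4 3 (U x \o K' x).
  apply: (cls_weaken fk) (cls_comp fk (hU x) (hK' x)).
  by exists (1 - alpha x.1)%N; have := alpha1 x.1; lia.
pose W := lsum [set: 'I_N * nat] (fun x => U x \o K' x).
have hW : cls 4 3 W.
  (* The weight bounds of the composites do not decrease with x, so local finiteness comes from the
     inner factor: [K' x] kills [p] once [x.2] is large. *)
  apply: (cls_lsum fk) => [p|x _].
    have [b hb] := Fop_vanish fk p.
    apply: (@sub_finite_set _ _ ([set: 'I_N] `*` `I_(b + 2).+1)); last first.
      by apply: finite_setX; [exact: finite_finset|exact: finite_II].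
    move=> x [_ ne]; split => //=; rewrite ltnNge; apply/negP => le; apply: ne.
    have [lU _ _] := hU x; have [lK fK _] := hK' x.
    have Kx0 : K' x p = 0.
      by apply: hb lK fK _; have := alpha1 x.1; lia.
    by rewrite /= Kx0; exact: (lin0 lU).
  exact: hUK.
have [A [B e]] := cubic_form fk F0 (conj_cls hR hW).
exists (fun a b c i j k => A a b c i j k / (Jscale F i * Jscale F j * Jscale F k)),
  (fun a j => B a j / Jscale F j) => Z hVir hH n.
transitivity (Rop r (W (Ri (hser_of Z n)))); last first.
  exact: (congr1 (fun f : Top => f (hser_of Z n)) (etrans e (esym (WopE F0 A B)))).
pose y : hser F N := fun k => Ri (hser_of Z k).
have RK p : Ri (Rop r p) = p := congr1 (fun f : Tpoly -> Tpoly => f p) (conjKV hR).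
(* As m runs over m >= -alpha, j = m + alpha runs over all naturals, so every derivative gets an
   equation. *)
have hLam a (j : nat) k :
    Lambda alpha s DeltaT a (j%:Z - (alpha a)%:Z) y k = 0.
  have le : - (alpha a)%:Z <= j%:Z - (alpha a)%:Z by lia.
  have := hVir a _ le k; rewrite /Vir (opinvE hR) => h.
  rewrite -[LHS]RK; etransitivity; first exact: (congr1 Ri h).
  exact: (lin0 (conj_linr hR)).
have hann x : ann (@Tgen F N) x (y (n + 1)) = K' x (y n).
  have [_ h] := hK x.1.
  have h1 := h _ _ (fun j => constraint_series (hLam x.1 j n)) x.2.
  transitivity ((dfact F (2 * x.2%:Z + 1))^-1 *: oddD x.1 x.2 (y (n + 1))); last first.
    exact: (congr1 (fun p : Tpoly => (dfact F (2 * x.2%:Z + 1))^-1 *: p) h1).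
  symmetry; etransitivity; first exact: scalerA.
  have -> : (dfact F (2 * x.2%:Z + 1))^-1 * dfact F (2 * x.2%:Z + 1) = 1.
    by rewrite mulVf ?dfact_neq0.
  exact: scale1r.
(* The dimension constraint is used one degree higher, at n + 1, where the derivatives of
   [y (n + 1)] are known in terms of [y n]. *)
transitivity (hbar (hdiff (hser_of Z)) (n + 1)).
  by rewrite /hbar addrK.
rewrite hH /hlift /Hop (opinvE hR) (opinvE hV).
transitivity (Rop r (Q (y (n + 1)))); first reflexivity.
rewrite QU; apply: (congr1 (Rop r)); apply: eq_fsbigr => x _.
exact: (congr1 (U x) (hann x)).
Qed.

End CutAndJoin.

Theorem mainTheorem7 (R : realType) (N : nat) (hN : (1 <= N)%N)
    (alpha : 'I_N -> nat) (halpha : forall a, alpha a = 0%N \/ alpha a = 1%N)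
    (r : nat -> 'M[R[i]]_N)
    (DeltaT : 'I_N -> nat -> R[i])
    (hDeltaT : forall a, alpha a = 1%N -> DeltaT a 1%N = 0)
    (Delta sqrtDelta : 'I_N -> R[i]) (hDelta : forall a, Delta a != 0)
    (hsqrt : forall a, sqrtDelta a ^+ 2 = Delta a)
    (chi : 'I_N -> nat -> R[i])
    (hchi : forall a n, fser (alpha a) (sqrtDelta a) (DeltaT a) n
                        = fps_flow (odd_field (chi a)) (fps_z _) n) :
  exists (A : 'I_N -> 'I_N -> 'I_N -> int -> int -> int -> R[i])
         (B : 'I_N -> int -> R[i]),
  forall Z : nat -> Tpoly R[i] N,
    (forall a (m : int), - (alpha a)%:Z <= m ->
       forall n, Vir alpha r sqrtDelta DeltaT a m (hser_of Z) n = 0) ->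
    (forall n, hbar (hdiff (hser_of Z)) n
               = hlift (Hop alpha r chi) (hser_of Z) n) ->
    forall n, hdiff (hser_of Z) n = hlift (Wop A B) (hser_of Z) n.
Proof.
apply: cut_and_join_exists.
- by move=> n; rewrite pnatr_eq0.
- by move=> a; have := hDelta a; rewrite -hsqrt sqrf_eq0.
- by move=> a; have [->|->] := halpha a.
Qed.
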